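(* Let $V=\mathrm{Sym}(3,\mathbb{C})$ be the space of complex symmetric $3\times 3$ matrices, with $G=\mathrm{SL}(3,\mathbb{C})$ acting by $g\cdot x=gxg^t$, and let $A(3)=\mathbb{C}[V\oplus V\oplus V]^G$ be the algebra of polynomial functions of $(x,y,z)\in V\oplus V\oplus V$ invariant under the diagonal action of $G$. Let $f_1,\dots,f_{10}\in A(3)$ be the ten polynomials $$\det x,\ \det y,\ \det z,\ f(x,x,y),\ f(x,x,z),\ f(y,y,x),\ f(y,y,z),\ f(z,z,x),\ f(z,z,y),\ f(x,y,z),$$ and let $f_{11}(x,y,z)=f(\mathrm{n}(x),\mathrm{n}(y),\mathrm{n}(z))$. Then $A(3)$ is a free $\mathbb{C}[f_1,\dots,f_{10}]$-module with basis $(1,f_{11},f_{11}^2)$.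
   Context: $f$ denotes the symmetric trilinear form on $V$ obtained by full polarization of $\det$, normalized by $f(x,x,x)=6\det x$; equivalently $f(x,y,z)$ is the coefficient of $abc$ in $\det(ax+by+cz)$. The map $\mathrm{n}:V\to V$ is the quadratic map sending $x$ to its adjugate matrix (transpose of the cofactor matrix), so that $x^{-1}=\mathrm{n}(x)/\det x$ when $x$ is invertible. *)

(* Defs.v *)
From HB Require Import structures.
From mathcomp Require Export all_boot all_order all_algebra.
From mathcomp Require Export complex.
From mathcomp Require Export boolp classical_sets functions reals.
From mathcomp Require Export mpoly.

Set Implicit Arguments.
Unset Strict Implicit.
Unset Printing Implicit Defensive.

Import GRing.Theory.
Local Open Scope ring_scope.

Section SymmetricMatrices.
Variables (K : fieldType) (n : nat).

Definition is_sym_mx : {pred 'M[K]_n} := fun x => x \is symmetricmx.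

Record sym_matrix := SymMatrix {
  sym_val :> 'M[K]_n;
  sym_valP : sym_val \in is_sym_mx }.

HB.instance Definition _ := [isSub for sym_val].
HB.instance Definition _ := [Choice of sym_matrix by <:].

Lemma is_sym_mxP (x : 'M[K]_n) : reflect (x^T = x) (x \in is_sym_mx).
Proof.
by apply: (iffP (is_hermitianmxP _ _ _)); rewrite expr0 scale1r map_mx_id.
Qed.

Fact sym_mx_submod_closed : submod_closed is_sym_mx.
Proof.
split=> [|a x y]; first by apply/is_sym_mxP; rewrite trmx0.
move=> /is_sym_mxP xT /is_sym_mxP yT; apply/is_sym_mxP.
by rewrite linearD linearZ /= xT yT.
Qed.

HB.instance Definition _ := GRing.isSubmodClosed.Build K 'M[K]_n
  is_sym_mx sym_mx_submod_closed.
HB.instance Definition _ := [SubChoice_isSubLmodule of sym_matrix by <:].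

Fact sym_congr_subproof (g : 'M[K]_n) (x : sym_matrix) :
  g *m x *m g^T \in is_sym_mx.
Proof.
apply/is_sym_mxP; rewrite !trmx_mul trmxK mulmxA.
by have /is_sym_mxP -> := sym_valP x.
Qed.

Definition sym_congr (g : 'M[K]_n) (x : sym_matrix) : sym_matrix :=
  SymMatrix (sym_congr_subproof g x).

Fact sym_adj_subproof (x : sym_matrix) : \adj x \in is_sym_mx.
Proof.
apply/is_sym_mxP; rewrite trmx_adj.
by have /is_sym_mxP -> := sym_valP x.
Qed.

Definition sym_adj (x : sym_matrix) : sym_matrix :=
  SymMatrix (sym_adj_subproof x).

End SymmetricMatrices.

(* The coefficient of abc in det (a x + b y + c z), where a, b, c are the three
   indeterminates of {mpoly K[3]}. *)
Definition polar_det (K : fieldType) (x y z : 'M[K]_3) : K :=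
  (\det (\sum_(i < 3) 'X_i *:
     map_mx (@mpolyC 3 K) (tnth [tuple x; y; z] i)))@_[multinom 1%N | i < 3].

(* Polynomials in finitely many linear forms on W. *)
Definition polynomial_function (K : fieldType) (W : lmodType K) (F : W -> K) :=
  exists (n : nat) (l : 'I_n -> {scalar W}) (p : {mpoly K[n]}),
    F = fun w => p.@[fun i => l i w].

Definition adjoin (K : fieldType) (W : Type) (n : nat)
    (s : n.-tuple (W -> K)) : set (W -> K) :=
  [set h | exists p : {mpoly K[n]}, h = fun w => p.@[fun i => tnth s i w]].

(* Inside the commutative ring S, the set B is a subring, M is a B-submodule,
   and M is free over B with basis e. *)
Definition free_module_basis (S : comPzRingType) (B M : set S)
    (n : nat) (e : n.-tuple S) : Prop :=
  [/\ [/\ B 1, (forall a b, B a -> B b -> B (a - b))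
         & forall a b, B a -> B b -> B (a * b)],
      [/\ M 0, (forall u v, M u -> M v -> M (u + v))
         & forall b u, B b -> M u -> M (b * u)],
      forall i, M (tnth e i),
      forall u, M u -> exists2 c : 'I_n -> S,
        (forall i, B (c i)) & u = \sum_(i < n) c i * tnth e i
    & forall c : 'I_n -> S, (forall i, B (c i)) ->
        \sum_(i < n) c i * tnth e i = 0 -> forall i, c i = 0].

Section TernaryInvariants.
Variable K : fieldType.

Local Notation V := (sym_matrix K 3).

Definition diag_congr (g : 'M[K]_3) (v : V * V * V) : V * V * V :=
  (sym_congr g v.1.1, sym_congr g v.1.2, sym_congr g v.2).

Definition invariants3 : set (V * V * V -> K) :=
  [set F | polynomial_function F /\
           forall g : 'M[K]_3, \det g = 1 ->
           forall v, F (diag_congr g v) = F v].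

Definition on_triple (h : V -> V -> V -> K) : V * V * V -> K :=
  fun v => h v.1.1 v.1.2 v.2.

Definition f1_to_f10 : 10.-tuple (V * V * V -> K) :=
  [tuple on_triple (fun x y z => \det x);
         on_triple (fun x y z => \det y);
         on_triple (fun x y z => \det z);
         on_triple (fun x y z => polar_det x x y);
         on_triple (fun x y z => polar_det x x z);
         on_triple (fun x y z => polar_det y y x);
         on_triple (fun x y z => polar_det y y z);
         on_triple (fun x y z => polar_det z z x);
         on_triple (fun x y z => polar_det z z y);
         on_triple (fun x y z => polar_det x y z)].

Definition f11 : V * V * V -> K :=
  on_triple (fun x y z =>
    polar_det (sym_adj x) (sym_adj y) (sym_adj z)).

End TernaryInvariants.

(* Main.v *)
From HB Require Import structures.
Require Import Defs.
From mathcomp Require Import ring.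
Import GRing.Theory Num.Theory.
Local Open Scope ring_scope.
Set Implicit Arguments.
Unset Strict Implicit.
Unset Printing Implicit Defensive.

(** Write B for the algebra C[f1, ..., f10] and M for B + B f11 + B f11^2; the
    claim is that M is the whole invariant algebra and that the sum is direct.

    Slice.  If det x is nonzero and the binary cubic det (a x + b y) has nonzero
    discriminant, then x and y are simultaneously diagonalized by a congruence,
    so that some element of SL3 sends (x, y, z) to a triple
    (l I, l diag(y1, y2, y3), l z') with distinct y_i ([slice_normal_form]).
    An invariant is therefore known from its restriction to these triples,
    which is a polynomial in l, the y_i, the diagonal entries a_i and the
    off-diagonal entries p_i of z', fixed by the cube roots of unity acting on
    l, by sign changes of the p_i and by simultaneous permutations.  Let E be
    det x times the discriminant, an element of B that is invertible on the
    slice.  Given the y_i, the a_i solve a Vandermonde system whose right-hand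
    side is in B[1/E], and so do the diagonal entries of adj z' if f11 is also
    allowed on the right-hand side; hence all p_i^2 = a_j a_k - adj(z')_ii and
    also p1 p2 p3 (through det z') belong to M[1/E][y1, y2, y3].  The relation
    (p1 p2 p3)^2 = p1^2 p2^2 p3^2 is a monic cubic equation for f11 over B[1/E]
    ([cubic_relation]), which makes M[1/E] a ring.  Averaging over the finite
    group now puts the restriction of every invariant into M[1/E]: for each
    invariant P some E^m P is in M ([localized_generation]).

    Independence.  Over a point of C^10 where E is nonzero, every root of the
    cubic equation is the value of f11 at some triple ([param_fvec_realised]),
    because the p_i can be recovered by square roots.  Generically the cubic
    has three distinct roots, so a polynomial of degree at most 2 in f11 with
    coefficients in B vanishes only if its coefficients do
    ([annihilator_vanishes]).

    Removing the denominator.  Applying the slice argument after the change of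
    variables (x, y, z) |-> (x + y + z, y - z, z), which maps M into itself,
    gives E'^n P in M for another element E' of B.  As a polynomial in
    f10 = f(x, y, z), E' has a constant leading coefficient, because the cubic
    a b c does not vanish at (1, 1, 1) and has three distinct roots on the line
    through (1, 1, 1) and (0, 1, -1); and E does not involve f10 at all.  So E
    and E' are coprime in the strong sense that E'^n a = E^m b forces E'^n to
    divide b ([monic_coprime]).  By independence this can be applied to the
    coefficients of E'^n (E^m P) = E^m (E'^n P), and P itself is in M. *)

(** * Three by three matrices *)

Definition i0 : 'I_3 := @Ordinal 3 0 isT.
Definition i1 : 'I_3 := @Ordinal 3 1 isT.
Definition i2 : 'I_3 := @Ordinal 3 2 isT.

Lemma big_ord3 (R : nmodType) (F : 'I_3 -> R) :
  \sum_(i < 3) F i = F i0 + F i1 + F i2.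
Proof.
rewrite !big_ord_recl big_ord0 addr0 addrA.
by congr (F _ + F _ + F _); apply: val_inj.
Qed.

Lemma ord3P (P : 'I_3 -> Prop) : P i0 -> P i1 -> P i2 -> forall i, P i.
Proof.
move=> P0 P1 P2 [[|[|[|//]]] lti]; [move: P0|move: P1|move: P2];
  by congr P; apply: val_inj.
Qed.

Lemma det_mx33 (R : comPzRingType) (A : 'M[R]_3) :
  \det A = A i0 i0 * (A i1 i1 * A i2 i2 - A i1 i2 * A i2 i1)
         - A i0 i1 * (A i1 i0 * A i2 i2 - A i1 i2 * A i2 i0)
         + A i0 i2 * (A i1 i0 * A i2 i1 - A i1 i1 * A i2 i0).
Proof.
rewrite (expand_det_row _ i0) big_ord3 /cofactor.
rewrite !(expand_det_row _ ord0) !big_ord_recl !big_ord0 /cofactor !det_mx11 !mxE.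
(* entries indexed by nat, so that the lifted ordinals of the minors compute *)
pose f (i j : nat) := A (inord i) (inord j).
have E i j : A i j = f i j by rewrite /f !inord_val.
by rewrite !E /= /bump /=; ring.
Qed.

Definition minor2 (R : comPzRingType) (A : 'M[R]_3) i j k l :=
  A i k * A j l - A i l * A j k.

Lemma adj_mx33 (R : comPzRingType) (A : 'M[R]_3) :
  \adj A = \matrix_(i, j) nth 0 (nth [::]
   [:: [:: minor2 A i1 i2 i1 i2; minor2 A i0 i2 i2 i1; minor2 A i0 i1 i1 i2];
       [:: minor2 A i1 i2 i2 i0; minor2 A i0 i2 i0 i2; minor2 A i0 i1 i2 i0];
       [:: minor2 A i1 i2 i0 i1; minor2 A i0 i2 i1 i0; minor2 A i0 i1 i0 i1]] i) j.
Proof.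
pose f (i j : nat) := A (inord i) (inord j).
have EA i j : A i j = f i j by rewrite /f !inord_val.
apply/matrixP; do 2![apply: ord3P];
  rewrite !mxE /cofactor !(expand_det_row _ ord0) !big_ord_recl !big_ord0
    /cofactor !det_mx11 !mxE /minor2 !EA /= /bump /=; ring.
Qed.

Lemma adj_mulmx33 (R : comPzRingType) (A B : 'M[R]_3) :
  \adj (A *m B) = \adj B *m \adj A.
Proof.
rewrite !adj_mx33; apply/matrixP; do 2![apply: ord3P];
  by rewrite !mxE big_ord3 !mxE /= /minor2 !mxE !big_ord3; ring.
Qed.

Section SymmetricEntries.
Variable K : fieldType.
Local Notation V := (sym_matrix K 3).

(** The coordinate p_i sits at the off-diagonal place that avoids the index i,
    so that a permutation of the basis permutes the a_i and the p_i alike. *)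
Definition sym6_mx (R : pzRingType) (a1 a2 a3 p1 p2 p3 : R) : 'M[R]_3 :=
  \matrix_(i, j) nth 0 (nth [::]
     [:: [:: a1; p3; p2]; [:: p3; a2; p1]; [:: p2; p1; a3]] i) j.

Fact sym6_subproof (a1 a2 a3 p1 p2 p3 : K) :
  sym6_mx a1 a2 a3 p1 p2 p3 \in @is_sym_mx K 3.
Proof. by apply/is_sym_mxP/matrixP; do 2![apply: ord3P]; rewrite !mxE. Qed.

Definition sym6 (a1 a2 a3 p1 p2 p3 : K) : V :=
  SymMatrix (sym6_subproof a1 a2 a3 p1 p2 p3).

Lemma sym6_eta (x : V) :
  x = sym6 (x i0 i0) (x i1 i1) (x i2 i2) (x i1 i2) (x i0 i2) (x i0 i1).
Proof.
have /is_sym_mxP /matrixP xT := sym_valP x.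
apply/val_inj/matrixP; do 2![apply: ord3P]; rewrite !mxE //=;
  by rewrite -[LHS]xT mxE.
Qed.

Lemma sym6D (a1 a2 a3 p1 p2 p3 b1 b2 b3 q1 q2 q3 : K) :
  sym6 a1 a2 a3 p1 p2 p3 + sym6 b1 b2 b3 q1 q2 q3 =
  sym6 (a1 + b1) (a2 + b2) (a3 + b3) (p1 + q1) (p2 + q2) (p3 + q3).
Proof. by apply/val_inj/matrixP; do 2![apply: ord3P]; rewrite !mxE. Qed.

Lemma sym6N (a1 a2 a3 p1 p2 p3 : K) :
  - sym6 a1 a2 a3 p1 p2 p3 = sym6 (- a1) (- a2) (- a3) (- p1) (- p2) (- p3).
Proof. by apply/val_inj/matrixP; do 2![apply: ord3P]; rewrite !mxE. Qed.

Lemma sym6_basis (a1 a2 a3 p1 p2 p3 : K) : sym6 a1 a2 a3 p1 p2 p3 =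
  a1 *: sym6 1 0 0 0 0 0 + a2 *: sym6 0 1 0 0 0 0 + a3 *: sym6 0 0 1 0 0 0
  + p1 *: sym6 0 0 0 1 0 0 + p2 *: sym6 0 0 0 0 1 0 + p3 *: sym6 0 0 0 0 0 1.
Proof.
by apply/val_inj/matrixP; do 2![apply: ord3P]; rewrite !mxE /=; ring.
Qed.

Lemma triple_sym6 (x y z : V) :
  exists a1 a2 a3 p1 p2 p3 b1 b2 b3 q1 q2 q3 c1 c2 c3 r1 r2 r3,
  (x, y, z) = (sym6 a1 a2 a3 p1 p2 p3, sym6 b1 b2 b3 q1 q2 q3,
               sym6 c1 c2 c3 r1 r2 r3).
Proof.
by rewrite (sym6_eta x) (sym6_eta y) (sym6_eta z); do 18!eexists.
Qed.

Definition det6 (R : pzRingType) (a1 a2 a3 p1 p2 p3 : R) : R :=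
  a1 * a2 * a3 + 2 * p1 * p2 * p3 - a1 * p1 ^+ 2 - a2 * p2 ^+ 2 - a3 * p3 ^+ 2.

Lemma det_sym6 (a1 a2 a3 p1 p2 p3 : K) :
  \det (sym6 a1 a2 a3 p1 p2 p3) = det6 a1 a2 a3 p1 p2 p3.
Proof. by rewrite det_mx33 !mxE /= /det6; ring. Qed.

Lemma adj_sym6 (a1 a2 a3 p1 p2 p3 : K) :
  sym_adj (sym6 a1 a2 a3 p1 p2 p3) =
  sym6 (a2 * a3 - p1 ^+ 2) (a1 * a3 - p2 ^+ 2) (a1 * a2 - p3 ^+ 2)
       (p2 * p3 - a1 * p1) (p1 * p3 - a2 * p2) (p1 * p2 - a3 * p3).
Proof.
apply/val_inj/matrixP; do 2![apply: ord3P];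
  rewrite !mxE /cofactor !(expand_det_row _ ord0) !big_ord_recl !big_ord0
    /cofactor !det_mx11 !mxE /= /bump /=; ring.
Qed.

Definition polar6 (R : pzRingType)
    (a1 a2 a3 p1 p2 p3 b1 b2 b3 q1 q2 q3 c1 c2 c3 r1 r2 r3 : R) : R :=
    a1 * (b2 * c3 + b3 * c2) + a2 * (b1 * c3 + b3 * c1)
  + a3 * (b1 * c2 + b2 * c1)
  + 2 * (p1 * (q2 * r3 + q3 * r2) + p2 * (q1 * r3 + q3 * r1)
         + p3 * (q1 * r2 + q2 * r1))
  - 2 * (a1 * q1 * r1 + a2 * q2 * r2 + a3 * q3 * r3)
  - 2 * (b1 * p1 * r1 + b2 * p2 * r2 + b3 * p3 * r3)
  - 2 * (c1 * p1 * q1 + c2 * p2 * q2 + c3 * p3 * q3).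

(** The trace of adj(x) y, which is f(x, x, y) / 2. *)
Definition half_polar6 (R : pzRingType)
    (a1 a2 a3 p1 p2 p3 b1 b2 b3 q1 q2 q3 : R) : R :=
  (a2 * a3 - p1 ^+ 2) * b1 + (a1 * a3 - p2 ^+ 2) * b2 + (a1 * a2 - p3 ^+ 2) * b3
  + 2 * ((p2 * p3 - a1 * p1) * q1 + (p1 * p3 - a2 * p2) * q2
         + (p1 * p2 - a3 * p3) * q3).

Lemma rmorph_polar6 (R S : comPzRingType) (f : {rmorphism R -> S})
    a1 a2 a3 p1 p2 p3 b1 b2 b3 q1 q2 q3 c1 c2 c3 r1 r2 r3 :
  f (polar6 a1 a2 a3 p1 p2 p3 b1 b2 b3 q1 q2 q3 c1 c2 c3 r1 r2 r3) =
  polar6 (f a1) (f a2) (f a3) (f p1) (f p2) (f p3)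
         (f b1) (f b2) (f b3) (f q1) (f q2) (f q3)
         (f c1) (f c2) (f c3) (f r1) (f r2) (f r3).
Proof. by rewrite /polar6 !(rmorphB, rmorphD, rmorphM, rmorph_nat). Qed.

(** All monomials in X, Y, Z other than XYZ are divisible by a square; grouping
    them in this way is all that the extraction of the coefficient of XYZ
    needs. *)
Lemma det6_pencil (R : comPzRingType)
    (X Y Z a1 a2 a3 p1 p2 p3 b1 b2 b3 q1 q2 q3 c1 c2 c3 r1 r2 r3 : R) :
  \det (X *: sym6_mx a1 a2 a3 p1 p2 p3 + Y *: sym6_mx b1 b2 b3 q1 q2 q3
        + Z *: sym6_mx c1 c2 c3 r1 r2 r3) =
  X * Y * Z * polar6 a1 a2 a3 p1 p2 p3 b1 b2 b3 q1 q2 q3 c1 c2 c3 r1 r2 r3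
  + X ^+ 2 * (X * det6 a1 a2 a3 p1 p2 p3
              + Y * half_polar6 a1 a2 a3 p1 p2 p3 b1 b2 b3 q1 q2 q3
              + Z * half_polar6 a1 a2 a3 p1 p2 p3 c1 c2 c3 r1 r2 r3)
  + Y ^+ 2 * (Y * det6 b1 b2 b3 q1 q2 q3
              + X * half_polar6 b1 b2 b3 q1 q2 q3 a1 a2 a3 p1 p2 p3
              + Z * half_polar6 b1 b2 b3 q1 q2 q3 c1 c2 c3 r1 r2 r3)
  + Z ^+ 2 * (Z * det6 c1 c2 c3 r1 r2 r3
              + X * half_polar6 c1 c2 c3 r1 r2 r3 a1 a2 a3 p1 p2 p3
              + Y * half_polar6 c1 c2 c3 r1 r2 r3 b1 b2 b3 q1 q2 q3).
Proof. by rewrite det_mx33 !mxE /= /polar6 /half_polar6 /det6; ring. Qed.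

Lemma polar_det_sym6
    (a1 a2 a3 p1 p2 p3 b1 b2 b3 q1 q2 q3 c1 c2 c3 r1 r2 r3 : K) :
  polar_det (sym6 a1 a2 a3 p1 p2 p3) (sym6 b1 b2 b3 q1 q2 q3)
            (sym6 c1 c2 c3 r1 r2 r3) =
  polar6 a1 a2 a3 p1 p2 p3 b1 b2 b3 q1 q2 q3 c1 c2 c3 r1 r2 r3.
Proof.
pose m := [multinom 1%N | i < 3].
have Xm : 'X_[m] = 'X_i0 * 'X_i1 * 'X_i2 :> {mpoly K[3]}.
  rewrite -!mpolyXD; congr mpolyX; apply/mnmP; apply: ord3P;
  by rewrite !mnmDE !mnm1E mnmE.
have sq i (q : {mpoly K[3]}) : ('X_i ^+ 2 * q)@_m = 0.
  rewrite mpolyXn mcoeffM big1 // => k /eqP /mnmP /(_ i).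
  rewrite mcoeffX mnmDE /m mnmE; case: eqP => [<-|]; last by rewrite mul0r.
  by rewrite mulmnE mnm1E eqxx.
have cst (c : K) : ('X_i0 * 'X_i1 * 'X_i2 * c%:MP)@_m = c.
  by rewrite mulrC mcoeffCM -Xm mcoeffX eqxx mulr1.
have mapE a b c d e f : map_mx (@mpolyC 3 K) (sym6 a b c d e f) =
    sym6_mx a%:MP b%:MP c%:MP d%:MP e%:MP f%:MP.
  by apply/matrixP; do 2![apply: ord3P]; rewrite !mxE.
rewrite /polar_det big_ord3 /= !mapE det6_pencil -(rmorph_polar6 (@mpolyC 3 K)).
by rewrite !mcoeffD !sq !addr0 cst.
Qed.

Lemma polar_detE (x y z : V) : polar_det x y z =
  polar6 (x i0 i0) (x i1 i1) (x i2 i2) (x i1 i2) (x i0 i2) (x i0 i1)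
         (y i0 i0) (y i1 i1) (y i2 i2) (y i1 i2) (y i0 i2) (y i0 i1)
         (z i0 i0) (z i1 i1) (z i2 i2) (z i1 i2) (z i0 i2) (z i0 i1).
Proof.
by rewrite {1}(sym6_eta x) {1}(sym6_eta y) {1}(sym6_eta z) polar_det_sym6.
Qed.

End SymmetricEntries.

(** * Algebras of functions *)

Section FunctionAlgebras.
Variables (K : fieldType) (S : Type).
Implicit Types (F G h : S -> K) (A : (S -> K) -> Prop).

Definition function_algebra A :=
  [/\ forall c, A (fun=> c),
      forall F G, A F -> A G -> A (fun s => F s + G s)
    & forall F G, A F -> A G -> A (fun s => F s * G s)].

Section Closure.
Variables (A : (S -> K) -> Prop) (algA : function_algebra A).

Lemma algC c : A (fun=> c). Proof. by case: algA. Qed.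

Lemma algD F G : A F -> A G -> A (fun s => F s + G s).
Proof. by case: algA => _ + _; apply. Qed.

Lemma algM F G : A F -> A G -> A (fun s => F s * G s).
Proof. by case: algA => _ _; apply. Qed.

Lemma algN F : A F -> A (fun s => - F s).
Proof.
by move=> AF; under eq_fun do rewrite -mulN1r; apply: algM => //; apply: algC.
Qed.

Lemma algX F n : A F -> A (fun s => F s ^+ n).
Proof.
move=> AF; elim: n => [|n IH]; first exact: algC.
by under eq_fun do rewrite exprS; apply: algM.
Qed.

Lemma alg_meval n (p : {mpoly K[n]}) (h : 'I_n -> S -> K) :
  (forall i, A (h i)) -> A (fun s => p.@[fun i => h i s]).
Proof.
move=> Ah; elim/mpolyind: p => [|c m p _ _ IHp].
  by under eq_fun do rewrite meval0; apply: algC.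
under eq_fun do rewrite mevalD mevalZ mevalX.
apply: algD => //; apply: algM; first exact: algC.
elim: index_enum => [|i s IH].
  by under eq_fun do rewrite big_nil; apply: algC.
under eq_fun do rewrite big_cons.
by apply: algM => //; apply: algX.
Qed.

End Closure.

Section Adjunction.
Variables y1 y2 y3 : S -> K.

Inductive adjoin3 A : (S -> K) -> Prop :=
| Adjoin3_gen c n1 n2 n3 : A c ->
    adjoin3 A (fun s => c s * (y1 s ^+ n1 * y2 s ^+ n2 * y3 s ^+ n3))
| Adjoin3_add F G : adjoin3 A F -> adjoin3 A G -> adjoin3 A (fun s => F s + G s).

Lemma adjoin3_base A c : A c -> adjoin3 A c.
Proof.
move=> Ac; have := Adjoin3_gen 0 0 0 Ac.
by under eq_fun do rewrite !expr0 !mulr1.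
Qed.

Lemma adjoin3_alg A : function_algebra A -> function_algebra (adjoin3 A).
Proof.
move=> algA; split; first by move=> c; apply: adjoin3_base; apply: algC.
  exact: Adjoin3_add.
move=> F G AF; elim: AF G => [c n1 n2 n3 Ac|F1 F2 _ IH1 _ IH2] G AG; last first.
  by under eq_fun do rewrite mulrDl; apply: Adjoin3_add; [apply: IH1 | apply: IH2].
elim: AG => [d m1 m2 m3 Ad|G1 G2 _ IH1 _ IH2]; last first.
  by under eq_fun do rewrite mulrDr; apply: Adjoin3_add.
rewrite (_ : (fun s => _) = (fun s => (c s * d s) *
  (y1 s ^+ (n1 + m1) * y2 s ^+ (n2 + m2) * y3 s ^+ (n3 + m3)))).
  by apply: Adjoin3_gen; apply: algM.
by apply/funext => s; rewrite !exprD; ring.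
Qed.

Lemma adjoin3_vars A : function_algebra A ->
  [/\ adjoin3 A y1, adjoin3 A y2 & adjoin3 A y3].
Proof.
move=> algA; split.
- rewrite (_ : y1 = fun s => 1 * (y1 s ^+ 1 * y2 s ^+ 0 * y3 s ^+ 0)).
    exact: (Adjoin3_gen 1 0 0 (algC algA 1)).
  by apply/funext => s; ring.
- rewrite (_ : y2 = fun s => 1 * (y1 s ^+ 0 * y2 s ^+ 1 * y3 s ^+ 0)).
    exact: (Adjoin3_gen 0 1 0 (algC algA 1)).
  by apply/funext => s; ring.
- rewrite (_ : y3 = fun s => 1 * (y1 s ^+ 0 * y2 s ^+ 0 * y3 s ^+ 1)).
    exact: (Adjoin3_gen 0 0 1 (algC algA 1)).
  by apply/funext => s; ring.
Qed.

Section Symmetric.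
Variables (A : (S -> K) -> Prop) (algA : function_algebra A).
Hypothesis A1 : A (fun s => y1 s + y2 s + y3 s).
Hypothesis A2 : A (fun s => y1 s * y2 s + y1 s * y3 s + y2 s * y3 s).
Hypothesis A3 : A (fun s => y1 s * y2 s * y3 s).

Lemma power_sum_alg n : A (fun s => y1 s ^+ n + y2 s ^+ n + y3 s ^+ n).
Proof.
pose p n s := y1 s ^+ n + y2 s ^+ n + y3 s ^+ n.
suff: [/\ A (p n), A (p n.+1) & A (p n.+2)] by case.
elim: n => [|n [IH0 IH1 IH2]].
  split.
  - rewrite (_ : p 0 = fun=> 3); first exact: algC.
    by apply/funext => s; rewrite /p; ring.
  - rewrite (_ : p 1 = fun s => y1 s + y2 s + y3 s); first exact: A1.
    by apply/funext => s; rewrite /p; ring.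
  rewrite (_ : p 2 = fun s => (y1 s + y2 s + y3 s) * (y1 s + y2 s + y3 s)
      + (- 2) * (y1 s * y2 s + y1 s * y3 s + y2 s * y3 s)).
    by do ![exact: A1 | exact: A2 | exact: (algC algA) | apply: (algM algA)
           | apply: (algD algA)].
  by apply/funext => s; rewrite /p; ring.
split=> //.
(* every y_i is a root of T^3 - e1 T^2 + e2 T - e3 *)
rewrite (_ : p n.+3 = fun s => (y1 s + y2 s + y3 s) * p n.+2 s
   + - ((y1 s * y2 s + y1 s * y3 s + y2 s * y3 s) * p n.+1 s)
   + y1 s * y2 s * y3 s * p n s).
  by do ![exact: IH0 | exact: IH1 | exact: IH2 | exact: A1 | exact: A2
         | exact: A3 | apply: (algD algA) | apply: (algN algA)
         | apply: (algM algA)].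
by apply/funext => s; rewrite /p !exprS; ring.
Qed.

(** Inclusion-exclusion on coinciding indices expresses the symmetrized
    monomial through power sums. *)
Lemma sym_sum_alg n1 n2 n3 :
  A (fun s =>
     y1 s ^+ n1 * y2 s ^+ n2 * y3 s ^+ n3 + y2 s ^+ n1 * y3 s ^+ n2 * y1 s ^+ n3
   + y3 s ^+ n1 * y1 s ^+ n2 * y2 s ^+ n3 + y2 s ^+ n1 * y1 s ^+ n2 * y3 s ^+ n3
   + y1 s ^+ n1 * y3 s ^+ n2 * y2 s ^+ n3 + y3 s ^+ n1 * y2 s ^+ n2 * y1 s ^+ n3).
Proof.
pose p n s := y1 s ^+ n + y2 s ^+ n + y3 s ^+ n.
rewrite (_ : (fun s => _) = fun s => p n1 s * p n2 s * p n3 s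
   + - (p (n1 + n2)%N s * p n3 s) + - (p (n1 + n3)%N s * p n2 s)
   + - (p (n2 + n3)%N s * p n1 s) + 2 * p (n1 + n2 + n3)%N s).
  by do ![exact: power_sum_alg | exact: (algC algA) | apply: (algD algA)
         | apply: (algN algA) | apply: (algM algA)].
by apply/funext => s; rewrite /p !exprD; ring.
Qed.

End Symmetric.
End Adjunction.
End FunctionAlgebras.

Ltac in_algebra algA :=
  repeat first [ assumption | exact: (algC algA) | apply: (algX algA)
               | apply: (algM algA) | apply: (algD algA) | apply: (algN algA) ].

(** * Polynomial functions *)

Section PolynomialFunctions.
Variables (K : fieldType) (W : lmodType K).
Implicit Types F G : W -> K.

Lemma polyfun_linear F : linear_for *%R F -> polynomial_function F.
Proof.
move=> linF.
pose F' : {scalar W} := HB.pack F (GRing.isLinear.Build K W K *%R F linF).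
by exists 1%N, (fun=> F'), 'X_0; apply/funext => w; rewrite mevalXU.
Qed.

Lemma polyfun_comp_linear (W' : lmodType K) (L : W' -> W) F :
  linear L -> polynomial_function F -> polynomial_function (F \o L).
Proof.
move=> linL [n [l [p ->]]].
have ll i : linear_for *%R (fun w => l i (L w)).
  by move=> a u w; rewrite linL linearP.
pose l' i : {scalar W'} :=
  HB.pack (fun w => l i (L w)) (GRing.isLinear.Build K W' K *%R _ (ll i)).
by exists n, l', p.
Qed.

Lemma polyfun_op2 F G
    (op : forall n, {mpoly K[n]} -> {mpoly K[n]} -> {mpoly K[n]})
    (op0 : K -> K -> K) :
  (forall n p q v, (op n p q).@[v] = op0 p.@[v] q.@[v]) ->
  polynomial_function F -> polynomial_function G ->
  polynomial_function (fun w => op0 (F w) (G w)).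
Proof.
move=> opE [n [l [p ->]]] [m [k [q ->]]].
exists (n + m)%N.
exists (fun i => match fintype.split i with inl i => l i | inr i => k i end).
exists (op _ (p \mPo [tuple 'X_(lshift m i) | i < n])
             (q \mPo [tuple 'X_(rshift n i) | i < m])).
apply/funext => w; rewrite opE !comp_mpoly_meval; congr op0;
  apply: meval_eq => i; rewrite tnth_mktuple mevalXU.
  by have -> : fintype.split (lshift m i) = inl i := unsplitK (inl i).
by have -> : fintype.split (rshift n i) = inr i := unsplitK (inr i).
Qed.

Lemma polyfun_alg : function_algebra (@polynomial_function K W).
Proof.
split=> [c|F G|F G].
- exists 0%N, (fun=> (\0 : {scalar W})), c%:MP.
  by apply/funext => w; rewrite mevalC.
- apply: (polyfun_op2 (op := fun _ => +%R) (op0 := +%R)) => *.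
  by rewrite mevalD.
- apply: (polyfun_op2 (op := fun _ => *%R) (op0 := *%R)) => *.
  by rewrite mevalM.
Qed.

Lemma polyfun_line F (v w : W) : polynomial_function F ->
  exists q : {poly K}, forall t, F (v + t *: w) = q.[t].
Proof.
case=> n [l [p ->]].
exists (mmap polyC (fun i => (l i v)%:P + l i w *: 'X) p) => t.
elim/mpolyind: p => [|c m p _ _ IHp]; first by rewrite mmap0 meval0 horner0.
rewrite mmapD mmapZ mmapX mevalD mevalZ mevalX hornerD hornerM hornerC IHp.
congr (_ * _ + _); rewrite /mmap1 horner_prod; apply: eq_bigr => i _.
by rewrite horner_exp hornerD hornerC hornerZ hornerX linearD linearZ /= mulrC.
Qed.

End PolynomialFunctions.

Lemma poly_eq0_horner (K : numFieldType) (q : {poly K}) :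
  (forall t, q.[t] = 0) -> q = 0.
Proof.
move=> q0; apply/eqP; apply: contraT => nz_q.
have := max_poly_roots nz_q (rs := [seq i%:R | i <- iota 0 (size q)]).
rewrite map_inj_uniq ?iota_uniq; last first.
  by move=> a b /eqP; rewrite eqr_nat => /eqP.
rewrite size_map size_iota ltnn => -> //.
by apply/allP => t _; rewrite rootE q0.
Qed.

(** On the line from v to a point v0 with N v0 nonzero, N F = 0 is an equation
    between univariate polynomials.  This is the only form of Zariski density
    that is used below. *)
Lemma polyfun_dense (K : numFieldType) (W : lmodType K) (F N : W -> K) v0 :
  polynomial_function F -> polynomial_function N -> N v0 != 0 ->
  (forall v, N v * F v = 0) -> forall v, F v = 0.
Proof.
move=> pF pN Nv0 NF0 v.
have [f fE] := polyfun_line v (v0 - v) pF.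
have [n nE] := polyfun_line v (v0 - v) pN.
have nf0 : n * f = 0.
  by apply: poly_eq0_horner => t; rewrite hornerM -fE -nE NF0.
move/eqP: nf0; rewrite mulf_eq0 => /orP[] /eqP h.
  by move: Nv0; rewrite -[v0](subrK v) addrC -[v0 - v]scale1r nE h horner0 eqxx.
by rewrite -[v]addr0 -(scale0r (v0 - v)) fE h horner0.
Qed.

(** * The eleven invariants *)

Section Invariants.
Variable K : fieldType.
Local Notation V := (sym_matrix K 3).
Implicit Types (x y z : V) (v : V * V * V).

Definition fvec v : 'I_10 -> K := fun i => tnth (f1_to_f10 K) i v.

Lemma polar_det_congr (g a b c : 'M[K]_3) : \det g = 1 ->
  polar_det (g *m a *m g^T) (g *m b *m g^T) (g *m c *m g^T) = polar_det a b c.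
Proof.
move=> dg; rewrite /polar_det; congr mcoeff.
set G := map_mx (@mpolyC 3 K) g.
transitivity (\det (G *m (\sum_(i < 3) 'X_i *:
    map_mx (@mpolyC 3 K) (tnth [tuple a; b; c] i)) *m G^T)).
  congr (\det _); rewrite mulmx_sumr mulmx_suml; apply: eq_bigr => i _.
  rewrite -scalemxAr -scalemxAl; congr (_ *: _).
  rewrite matrix.map_trmx -!map_mxM; congr map_mx.
  by move: i; apply: ord3P.
have dG : \det G = 1 by rewrite /G det_map_mx dg rmorph1.
by rewrite !det_mulmx det_tr dG mul1r mulr1.
Qed.

(** The adjugate of g x g^t is h adj(x) h^t with h the transpose of adj(g),
    which again has determinant 1. *)
Lemma f11_congr (g : 'M[K]_3) v : \det g = 1 -> f11 (diag_congr g v) = f11 v.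
Proof.
move=> dg; rewrite /f11 /on_triple /= !adj_mulmx33 !mulmxA.
have -> : \adj g^T = (\adj g)^T by rewrite trmx_adj.
rewrite -{2 4 6}[\adj g]trmxK polar_det_congr //.
have := congr1 determinant (mul_mx_adj g).
by rewrite det_mulmx dg mul1r det_scalar expr1n det_tr.
Qed.

Lemma fvec_congr (g : 'M[K]_3) v : \det g = 1 -> fvec (diag_congr g v) = fvec v.
Proof.
move=> dg; apply/funext => i; rewrite /fvec.
case: i => -[|[|[|[|[|[|[|[|[|[|//]]]]]]]]]] ?;
  by rewrite !(tnth_nth 0) /= /on_triple /= ?polar_det_congr // !det_mulmx
             det_tr dg mul1r mulr1.
Qed.

Lemma polyfun_coord1 i j : polynomial_function (fun v : V * V * V => v.1.1 i j).
Proof. by apply: polyfun_linear => a u v /=; rewrite !mxE. Qed.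

Lemma polyfun_coord2 i j : polynomial_function (fun v : V * V * V => v.1.2 i j).
Proof. by apply: polyfun_linear => a u v /=; rewrite !mxE. Qed.

Lemma polyfun_coord3 i j : polynomial_function (fun v : V * V * V => v.2 i j).
Proof. by apply: polyfun_linear => a u v /=; rewrite !mxE. Qed.

Ltac polyfun_coords := repeat first
  [ exact: polyfun_coord1 | exact: polyfun_coord2 | exact: polyfun_coord3
  | exact: (algC (polyfun_alg _)) | apply: (algX (polyfun_alg _))
  | apply: (algM (polyfun_alg _)) | apply: (algD (polyfun_alg _))
  | apply: (algN (polyfun_alg _)) ].

Lemma polyfun_fvec i : polynomial_function (fun v => fvec v i).
Proof.
case: i => -[|[|[|[|[|[|[|[|[|[|//]]]]]]]]]] ?; rewrite /fvec;
  under eq_fun do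
    rewrite (tnth_nth 0) /= /on_triple ?polar_detE ?det_mx33 /polar6 /=;
  polyfun_coords.
Qed.

Lemma polyfun_f11 : polynomial_function (@f11 K).
Proof.
rewrite /f11 /on_triple.
under eq_fun do rewrite polar_detE /= !adj_mx33 !mxE /polar6 /minor2 /=.
polyfun_coords.
Qed.

Lemma polyfun_meval_fvec (a : {mpoly K[10]}) :
  polynomial_function (fun v => a.@[fvec v]).
Proof.
by apply: (alg_meval (polyfun_alg _) a) => i; apply: polyfun_fvec.
Qed.

Lemma polyfun_f11_comb (a : 'I_3 -> {mpoly K[10]}) :
  polynomial_function (fun v => \sum_(i < 3) (a i).@[fvec v] * f11 v ^+ i).
Proof.
under eq_fun do rewrite big_ord3.
do ![apply: (algD (polyfun_alg _))]; apply: (algM (polyfun_alg _));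
  by [exact: polyfun_meval_fvec | apply/(algX (polyfun_alg _))/polyfun_f11].
Qed.

End Invariants.

(** * The slice *)

Section Slice.
Variable K : numClosedFieldType.
Local Notation V := (sym_matrix K 3).
Local Notation X k := ('X_(@Ordinal 10 k isT)).

(** The scalar l is a cube root of det x.  Keeping it as a coordinate lets SL3,
    and not only GL3, reach this normal form. *)
Definition slice_pt (l y1 y2 y3 a1 a2 a3 p1 p2 p3 : K) : V * V * V :=
  (sym6 l l l 0 0 0, sym6 (l * y1) (l * y2) (l * y3) 0 0 0,
   sym6 (l * a1) (l * a2) (l * a3) (l * p1) (l * p2) (l * p3)).

Lemma fvec_slice l y1 y2 y3 a1 a2 a3 p1 p2 p3
    (b1 := a2 * a3 - p1 ^+ 2) (b2 := a1 * a3 - p2 ^+ 2)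
    (b3 := a1 * a2 - p3 ^+ 2) :
  fvec (slice_pt l y1 y2 y3 a1 a2 a3 p1 p2 p3) = fun i => nth 0
  [:: l ^+ 3; l ^+ 3 * (y1 * y2 * y3);
      l ^+ 3 * (a1 * a2 * a3 + 2 * (p1 * p2 * p3)
                - a1 * p1 ^+ 2 - a2 * p2 ^+ 2 - a3 * p3 ^+ 2);
      l ^+ 3 * 2 * (y1 + y2 + y3);
      l ^+ 3 * 2 * (a1 + a2 + a3);
      l ^+ 3 * 2 * (y1 * y2 + y1 * y3 + y2 * y3);
      l ^+ 3 * 2 * (a1 * (y2 * y3) + a2 * (y1 * y3) + a3 * (y1 * y2));
      l ^+ 3 * 2 * (b1 + b2 + b3);
      l ^+ 3 * 2 * (y1 * b1 + y2 * b2 + y3 * b3);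
      l ^+ 3 * (a1 * (y2 + y3) + a2 * (y1 + y3) + a3 * (y1 + y2))] i.
Proof.
apply/funext; case=> -[|[|[|[|[|[|[|[|[|[|//]]]]]]]]]] ?;
  rewrite /fvec (tnth_nth 0) /= /on_triple /slice_pt ?polar_det_sym6 ?det_sym6;
  rewrite /polar6 /det6 /b1 /b2 /b3 /=; ring.
Qed.

Lemma f11_slice l y1 y2 y3 a1 a2 a3 p1 p2 p3
    (b1 := a2 * a3 - p1 ^+ 2) (b2 := a1 * a3 - p2 ^+ 2)
    (b3 := a1 * a2 - p3 ^+ 2) :
  f11 (slice_pt l y1 y2 y3 a1 a2 a3 p1 p2 p3) =
  l ^+ 6 * (y1 * (y2 + y3) * b1 + y2 * (y1 + y3) * b2 + y3 * (y1 + y2) * b3).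
Proof.
rewrite -[LHS]/(polar_det (sym_adj (sym6 _ _ _ _ _ _))
  (sym_adj (sym6 _ _ _ _ _ _)) (sym_adj (sym6 _ _ _ _ _ _))).
by rewrite !adj_sym6 polar_det_sym6 /polar6 /b1 /b2 /b3 /=; ring.
Qed.

(** Sixteen times the discriminant of the binary cubic det (a x + b y), whose
    coefficients are X 0, X 3 / 2, X 5 / 2 and X 1. *)
Definition pencil_disc : {mpoly K[10]} :=
  X 3 ^+ 2 * X 5 ^+ 2 - (8 : K)%:MP * X 0 * X 5 ^+ 3
  - (8 : K)%:MP * X 3 ^+ 3 * X 1
  + (72 : K)%:MP * X 0 * X 1 * X 3 * X 5 - (432 : K)%:MP * X 0 ^+ 2 * X 1 ^+ 2.

Definition pencil_den := X 0 * pencil_disc.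

Definition mevalS := (mevalB, mevalD, mevalM, rmorphXn, mevalC, mevalXU).

Lemma pencil_denE (c : 'I_10 -> K)
    (c0 := c (@Ordinal 10 0 isT)) (c1 := c (@Ordinal 10 1 isT))
    (c3 := c (@Ordinal 10 3 isT)) (c5 := c (@Ordinal 10 5 isT)) :
  pencil_den.@[c] = c0 * (c3 ^+ 2 * c5 ^+ 2 - 8 * c0 * c5 ^+ 3
    - 8 * c3 ^+ 3 * c1 + 72 * c0 * c1 * c3 * c5 - 432 * c0 ^+ 2 * c1 ^+ 2).
Proof. by rewrite /pencil_den /pencil_disc !mevalS. Qed.

Lemma pencil_disc_slice l y1 y2 y3 a1 a2 a3 p1 p2 p3 :
  pencil_disc.@[fvec (slice_pt l y1 y2 y3 a1 a2 a3 p1 p2 p3)] =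
  16 * l ^+ 12 * ((y1 - y2) * (y1 - y3) * (y2 - y3)) ^+ 2.
Proof. by rewrite fvec_slice /pencil_disc !mevalS /=; ring. Qed.

End Slice.

(** * The cubic equation for f11 *)

Section Cubic.
Variable K : fieldType.
Implicit Types (y a : K).

Definition vandermonde3 y1 y2 y3 : K := (y1 - y2) * (y1 - y3) * (y2 - y3).

(** With phi = f11 / l^6 and b_i the diagonal entries of the adjugate of the
    third matrix, B0 = sum b_i and B1 = sum y_i b_i, this is the constant for
    which p1^2 (y1 - y2) (y1 - y3) = phi + kappa. *)
Definition kappa y1 y2 y3 a2 a3 B0 B1 : K :=
  a2 * a3 * ((y1 - y2) * (y1 - y3)) - y1 * B1 - y2 * y3 * B0.

(** The product p1 p2 p3, read off from the determinant d of the third matrix,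
    becomes lin0 + lin1 * phi when multiplied by the Vandermonde determinant. *)
Definition lin1 y1 y2 y3 a1 a2 a3 : K :=
  (a1 * (y2 - y3) - a2 * (y1 - y3) + a3 * (y1 - y2)) / 2.

Definition lin0 y1 y2 y3 a1 a2 a3 B0 B1 d : K :=
  (vandermonde3 y1 y2 y3 * (d - a1 * a2 * a3)
   + a1 * (y2 - y3) * kappa y1 y2 y3 a2 a3 B0 B1
   - a2 * (y1 - y3) * kappa y2 y1 y3 a1 a3 B0 B1
   + a3 * (y1 - y2) * kappa y3 y1 y2 a1 a2 B0 B1) / 2.

Definition cub2 y1 y2 y3 a1 a2 a3 B0 B1 : K :=
  kappa y1 y2 y3 a2 a3 B0 B1 + kappa y2 y1 y3 a1 a3 B0 B1
  + kappa y3 y1 y2 a1 a2 B0 B1 + lin1 y1 y2 y3 a1 a2 a3 ^+ 2.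

Definition cub1 y1 y2 y3 a1 a2 a3 B0 B1 d : K :=
  kappa y1 y2 y3 a2 a3 B0 B1 * kappa y2 y1 y3 a1 a3 B0 B1
  + kappa y1 y2 y3 a2 a3 B0 B1 * kappa y3 y1 y2 a1 a2 B0 B1
  + kappa y2 y1 y3 a1 a3 B0 B1 * kappa y3 y1 y2 a1 a2 B0 B1
  + 2 * lin0 y1 y2 y3 a1 a2 a3 B0 B1 d * lin1 y1 y2 y3 a1 a2 a3.

Definition cub0 y1 y2 y3 a1 a2 a3 B0 B1 d : K :=
  kappa y1 y2 y3 a2 a3 B0 B1 * kappa y2 y1 y3 a1 a3 B0 B1
    * kappa y3 y1 y2 a1 a2 B0 B1
  + lin0 y1 y2 y3 a1 a2 a3 B0 B1 d ^+ 2.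

End Cubic.

Section CubicRelation.
Variables (K : numFieldType) (y1 y2 y3 a1 a2 a3 p1 p2 p3 : K).
Let b1 := a2 * a3 - p1 ^+ 2.
Let b2 := a1 * a3 - p2 ^+ 2.
Let b3 := a1 * a2 - p3 ^+ 2.
Let B0 := b1 + b2 + b3.
Let B1 := y1 * b1 + y2 * b2 + y3 * b3.
Let phi := y1 * (y2 + y3) * b1 + y2 * (y1 + y3) * b2 + y3 * (y1 + y2) * b3.
Let d := a1 * a2 * a3 + 2 * (p1 * p2 * p3)
         - a1 * p1 ^+ 2 - a2 * p2 ^+ 2 - a3 * p3 ^+ 2.

(** This is p1^2 p2^2 p3^2 = (p1 p2 p3)^2.  The product of the three
    denominators (y_i - y_j) (y_i - y_k) is minus the square of the Vandermonde
    determinant, so that the two sides add up to a monic cubic in phi. *)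
Lemma cubic_relation :
  phi ^+ 3 = - (cub2 y1 y2 y3 a1 a2 a3 B0 B1 * phi ^+ 2
    + cub1 y1 y2 y3 a1 a2 a3 B0 B1 d * phi + cub0 y1 y2 y3 a1 a2 a3 B0 B1 d).
Proof.
have w1 : p1 ^+ 2 * ((y1 - y2) * (y1 - y3)) = phi + kappa y1 y2 y3 a2 a3 B0 B1.
  by rewrite /kappa /phi /B0 /B1 /b1 /b2 /b3; ring.
have w2 : p2 ^+ 2 * ((y2 - y1) * (y2 - y3)) = phi + kappa y2 y1 y3 a1 a3 B0 B1.
  by rewrite /kappa /phi /B0 /B1 /b1 /b2 /b3; ring.
have w3 : p3 ^+ 2 * ((y3 - y1) * (y3 - y2)) = phi + kappa y3 y1 y2 a1 a2 B0 B1.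
  by rewrite /kappa /phi /B0 /B1 /b1 /b2 /b3; ring.
have u : vandermonde3 y1 y2 y3 * (p1 * p2 * p3) =
    lin0 y1 y2 y3 a1 a2 a3 B0 B1 d + lin1 y1 y2 y3 a1 a2 a3 * phi.
  rewrite /lin0 /lin1.
  have -> : kappa y1 y2 y3 a2 a3 B0 B1
      = p1 ^+ 2 * ((y1 - y2) * (y1 - y3)) - phi by rewrite w1; ring.
  have -> : kappa y2 y1 y3 a1 a3 B0 B1
      = p2 ^+ 2 * ((y2 - y1) * (y2 - y3)) - phi by rewrite w2; ring.
  have -> : kappa y3 y1 y2 a1 a2 B0 B1
      = p3 ^+ 2 * ((y3 - y1) * (y3 - y2)) - phi by rewrite w3; ring.
  by rewrite /d /vandermonde3; field.
have rel : (phi + kappa y1 y2 y3 a2 a3 B0 B1)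
      * (phi + kappa y2 y1 y3 a1 a3 B0 B1) * (phi + kappa y3 y1 y2 a1 a2 B0 B1)
    + (lin0 y1 y2 y3 a1 a2 a3 B0 B1 d
       + lin1 y1 y2 y3 a1 a2 a3 * phi) ^+ 2 = 0.
  by rewrite -w1 -w2 -w3 -u /vandermonde3; ring.
apply/eqP; rewrite -addr_eq0 -[X in _ == X]rel /cub2 /cub1 /cub0.
by apply/eqP; ring.
Qed.

End CubicRelation.

(** * Localization of the invariants on the slice *)

Section Localization.
Variable K : numClosedFieldType.
Local Notation X k := ('X_(@Ordinal 10 k isT)).

Record slice_param := SliceParam {
  sl : K; sy1 : K; sy2 : K; sy3 : K;
  sa1 : K; sa2 : K; sa3 : K; sp1 : K; sp2 : K; sp3 : K;
  sl_neq0 : sl != 0;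
  sy12 : sy1 - sy2 != 0; sy13 : sy1 - sy3 != 0; sy23 : sy2 - sy3 != 0 }.
Implicit Types (s : slice_param) (h : slice_param -> K).

Definition slice_of s := slice_pt (sl s) (sy1 s) (sy2 s) (sy3 s)
  (sa1 s) (sa2 s) (sa3 s) (sp1 s) (sp2 s) (sp3 s).

Definition slice_den s := (pencil_den K).@[fvec (slice_of s)].

Lemma slice_denE s :
  slice_den s = 16 * sl s ^+ 15 * vandermonde3 (sy1 s) (sy2 s) (sy3 s) ^+ 2.
Proof.
rewrite /slice_den /pencil_den mevalM pencil_disc_slice mevalXU fvec_slice.
by rewrite /vandermonde3 /=; ring.
Qed.

Lemma svandermonde_neq0 s : vandermonde3 (sy1 s) (sy2 s) (sy3 s) != 0.
Proof. by rewrite /vandermonde3 !mulf_neq0 ?sy12 ?sy13 ?sy23. Qed.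

Lemma slice_den_neq0 s : slice_den s != 0.
Proof.
rewrite slice_denE; apply: mulf_neq0 (expf_neq0 _ (svandermonde_neq0 s)).
by apply: mulf_neq0 (expf_neq0 _ (sl_neq0 s)); rewrite pnatr_eq0.
Qed.

(** The functions on the slice induced by B[1/E]. *)
Definition local_B h := exists m (a : {mpoly K[10]}),
  forall s, slice_den s ^+ m * h s = a.@[fvec (slice_of s)].

Lemma local_B_alg : function_algebra local_B.
Proof.
split=> [c|F G [m [a aE]] [n [b bE]]|F G [m [a aE]] [n [b bE]]].
- by exists 0%N, c%:MP => s; rewrite mevalC mul1r.
- exists (m + n)%N, (pencil_den K ^+ n * a + pencil_den K ^+ m * b) => s.
  by rewrite !mevalS -aE -bE -/(slice_den s) exprD; ring.
- exists (m + n)%N, (a * b) => s.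
  by rewrite !mevalS -aE -bE exprD; ring.
Qed.

Lemma local_B_meval (p : {mpoly K[10]}) :
  local_B (fun s => p.@[fvec (slice_of s)]).
Proof. by exists 0%N, p => s; rewrite mul1r. Qed.

Lemma local_B_act (g : slice_param -> slice_param) h :
  (forall s, fvec (slice_of (g s)) = fvec (slice_of s)) ->
  local_B h -> forall s, h (g s) = h s.
Proof.
move=> gE [m [a aE]] s.
have dE : slice_den (g s) = slice_den s by rewrite /slice_den gE.
apply: (mulfI (expf_neq0 m (slice_den_neq0 s))).
by rewrite aE -{1}dE aE gE.
Qed.

Lemma local_B_vdm :
  local_B (fun s => (vandermonde3 (sy1 s) (sy2 s) (sy3 s) ^+ 2)^-1).
Proof.
exists 1%N, ((16 : K)%:MP * X 0 ^+ 5) => s.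
rewrite slice_denE !mevalS fvec_slice /=.
have v0 := svandermonde_neq0 s.
by field.
Qed.

Lemma local_B_l3 : local_B (fun s => sl s ^+ 3).
Proof.
rewrite (_ : (fun s => _) =
  fun s => (X 0 : {mpoly K[10]}).@[fvec (slice_of s)]).
  exact: local_B_meval.
by apply/funext => s; rewrite mevalXU fvec_slice.
Qed.

Lemma local_B_inv_l3 : local_B (fun s => (sl s ^+ 3)^-1).
Proof.
exists 1%N, (pencil_disc K) => s.
by rewrite slice_denE pencil_disc_slice /vandermonde3; field; exact: sl_neq0.
Qed.

Lemma local_B_div_l3 (p : {mpoly K[10]}) (c : K) h :
  (forall s, p.@[fvec (slice_of s)] = sl s ^+ 3 * c * h s) -> c != 0 ->
  local_B h.
Proof.
move=> pE c0.
rewrite (_ : h = fun s => (sl s ^+ 3)^-1 * (c^-1 * p.@[fvec (slice_of s)])).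
  apply: (algM local_B_alg local_B_inv_l3).
  exact: (algM local_B_alg (algC local_B_alg _) (local_B_meval p)).
by apply/funext => s; rewrite pE; field; rewrite c0 sl_neq0.
Qed.

Definition sb1 s := sa2 s * sa3 s - sp1 s ^+ 2.
Definition sb2 s := sa1 s * sa3 s - sp2 s ^+ 2.
Definition sb3 s := sa1 s * sa2 s - sp3 s ^+ 2.
Definition sB0 s := sb1 s + sb2 s + sb3 s.
Definition sB1 s := sy1 s * sb1 s + sy2 s * sb2 s + sy3 s * sb3 s.
Definition sT0 s := sa1 s + sa2 s + sa3 s.
Definition sT1 s :=
  sa1 s * (sy2 s * sy3 s) + sa2 s * (sy1 s * sy3 s) + sa3 s * (sy1 s * sy2 s).
Definition sT2 s :=
  sa1 s * (sy2 s + sy3 s) + sa2 s * (sy1 s + sy3 s) + sa3 s * (sy1 s + sy2 s).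
Definition sd s := sa1 s * sa2 s * sa3 s + 2 * (sp1 s * sp2 s * sp3 s)
   - sa1 s * sp1 s ^+ 2 - sa2 s * sp2 s ^+ 2 - sa3 s * sp3 s ^+ 2.

(** This is f11 / l^6, see [sphi_f11]. *)
Definition sphi s := sy1 s * (sy2 s + sy3 s) * sb1 s
   + sy2 s * (sy1 s + sy3 s) * sb2 s + sy3 s * (sy1 s + sy2 s) * sb3 s.

Lemma local_B_coefs : [/\
  [/\ local_B (fun s => sy1 s + sy2 s + sy3 s),
      local_B (fun s => sy1 s * sy2 s + sy1 s * sy3 s + sy2 s * sy3 s)
    & local_B (fun s => sy1 s * sy2 s * sy3 s)],
  [/\ local_B sT0, local_B sT1 & local_B sT2]
  & [/\ local_B sB0, local_B sB1 & local_B sd]].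
Proof.
have n2 : (2 : K) != 0 by rewrite pnatr_eq0.
have n1 : (1 : K) != 0 by rewrite oner_eq0.
split; split.
- by apply: (local_B_div_l3 (p := X 3) _ n2) => s; rewrite mevalXU fvec_slice.
- by apply: (local_B_div_l3 (p := X 5) _ n2) => s; rewrite mevalXU fvec_slice.
- apply: (local_B_div_l3 (p := X 1) _ n1) => s.
  by rewrite mevalXU fvec_slice mulr1.
- by apply: (local_B_div_l3 (p := X 4) _ n2) => s; rewrite mevalXU fvec_slice.
- by apply: (local_B_div_l3 (p := X 6) _ n2) => s; rewrite mevalXU fvec_slice.
- apply: (local_B_div_l3 (p := X 9) _ n1) => s.
  by rewrite mevalXU fvec_slice mulr1.
- by apply: (local_B_div_l3 (p := X 7) _ n2) => s; rewrite mevalXU fvec_slice.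
- by apply: (local_B_div_l3 (p := X 8) _ n2) => s; rewrite mevalXU fvec_slice.
- apply: (local_B_div_l3 (p := X 2) _ n1) => s.
  by rewrite mevalXU fvec_slice mulr1.
Qed.

Lemma local_B_common_den (c : 'I_3 -> slice_param -> K) :
  (forall i, local_B (c i)) ->
  exists n (a : 'I_3 -> {mpoly K[10]}),
    forall i s, slice_den s ^+ n * c i s = (a i).@[fvec (slice_of s)].
Proof.
move=> lc; have [k0 [a0 E0]] := lc i0.
have [k1 [a1 E1]] := lc i1; have [k2 [a2 E2]] := lc i2.
pose den := pencil_den K.
exists (k0 + k1 + k2)%N, (fun i => nth 0 [:: den ^+ (k1 + k2) * a0;
  den ^+ (k0 + k2) * a1; den ^+ (k0 + k1) * a2] i).
by apply: ord3P => s;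
  rewrite /= !mevalS -?E0 -?E1 -?E2 -/(slice_den s) !exprD; ring.
Qed.

End Localization.

(** * The finite group acting on the slice *)

Section Reynolds.
Variable K : numClosedFieldType.
Local Notation S := (slice_param K).
Implicit Types (s : S) (h c : S -> K) (A : (S -> K) -> Prop).

Lemma subr_neq0C (a b : K) : a - b != 0 -> b - a != 0.
Proof. by rewrite !subr_eq0 eq_sym. Qed.

Definition srot s : S := SliceParam (sa2 s) (sa3 s) (sa1 s)
  (sp2 s) (sp3 s) (sp1 s) (sl_neq0 s)
  (sy23 s) (subr_neq0C (sy12 s)) (subr_neq0C (sy13 s)).

Definition sswap s : S := SliceParam (sa2 s) (sa1 s) (sa3 s)
  (sp2 s) (sp1 s) (sp3 s) (sl_neq0 s)
  (subr_neq0C (sy12 s)) (sy23 s) (sy13 s).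

Definition sscale (w : K) (w0 : w != 0) s : S :=
  SliceParam (sa1 s) (sa2 s) (sa3 s) (sp1 s) (sp2 s) (sp3 s)
   (mulf_neq0 w0 (sl_neq0 s)) (sy12 s) (sy13 s) (sy23 s).

Definition ssign (e1 e2 e3 : K) s : S :=
  SliceParam (sa1 s) (sa2 s) (sa3 s) (e1 * sp1 s) (e2 * sp2 s) (e3 * sp3 s)
   (sl_neq0 s) (sy12 s) (sy13 s) (sy23 s).

Definition slice_action (g : S -> S) :=
  forall s, exists2 m : 'M[K]_3,
    \det m = 1 & slice_of (g s) = diag_congr m (slice_of s).

Lemma slice_of_srot : slice_action srot.
Proof.
move=> s; exists (\matrix_(i, j) (j == (i + 1) %% 3 :> nat)%N%:R).
  by rewrite det_mx33 !mxE /=; ring.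
set g := \matrix_(_, _) _.
have act x1 x2 x3 q1 q2 q3 :
    sym_congr g (sym6 x1 x2 x3 q1 q2 q3) = sym6 x2 x3 x1 q2 q3 q1.
  by apply/val_inj/matrixP; do 2![apply: ord3P];
    rewrite !mxE /= !big_ord3 !mxE !big_ord3 !mxE /=; ring.
by rewrite /slice_of /slice_pt /diag_congr /= !act.
Qed.

Lemma slice_of_sswap : slice_action sswap.
Proof.
(* a transposition matrix has determinant -1, its opposite has determinant 1 *)
move=> s; exists (\matrix_(i, j) - (j == nth 0 [:: 1; 0; 2] i :> nat)%N%:R).
  by rewrite det_mx33 !mxE /=; ring.
set g := \matrix_(_, _) _.
have act x1 x2 x3 q1 q2 q3 :
    sym_congr g (sym6 x1 x2 x3 q1 q2 q3) = sym6 x2 x1 x3 q2 q1 q3.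
  by apply/val_inj/matrixP; do 2![apply: ord3P];
    rewrite !mxE /= !big_ord3 !mxE !big_ord3 !mxE /=; ring.
by rewrite /slice_of /slice_pt /diag_congr /= !act.
Qed.

Lemma slice_of_sscale w (w0 : w != 0) : w ^+ 3 = 1 -> slice_action (sscale w0).
Proof.
(* the scalar matrix w^2 acts on V as w^4 = w *)
move=> w3 s; exists (w ^+ 2)%:M.
  by rewrite det_scalar -exprM mulnC exprM w3 expr1n.
have w4 u : w * u = w ^+ 2 * w ^+ 2 * u by rewrite -exprD exprS w3 mulr1.
have scal x1 x2 x3 q1 q2 q3 : sym_congr (w ^+ 2)%:M (sym6 x1 x2 x3 q1 q2 q3) =
    sym6 (w * x1) (w * x2) (w * x3) (w * q1) (w * q2) (w * q3).
  apply/val_inj; rewrite /= tr_scalar_mx mul_scalar_mx mul_mx_scalar scalerA.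
  by apply/matrixP; do 2![apply: ord3P]; rewrite !mxE /= w4.
by rewrite /slice_of /slice_pt /diag_congr /= !scal !mulr0 !mulrA.
Qed.

Lemma slice_of_ssign (e1 e2 e3 : K) :
  e1 ^+ 2 = 1 -> e2 ^+ 2 = 1 -> e3 = e1 * e2 -> slice_action (ssign e1 e2 e3).
Proof.
move=> E1 E2 -> s.
exists (\matrix_(i, j) nth 0 (nth [::]
  [:: [:: e1; 0; 0]; [:: 0; e2; 0]; [:: 0; 0; e1 * e2]] i) j).
  rewrite det_mx33 !mxE /=; transitivity (e1 ^+ 2 * e2 ^+ 2); first by ring.
  by rewrite E1 E2 mulr1.
set g := \matrix_(_, _) _.
have act x1 x2 x3 q1 q2 q3 : sym_congr g (sym6 x1 x2 x3 q1 q2 q3) =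
    sym6 (e1 ^+ 2 * x1) (e2 ^+ 2 * x2) (e1 ^+ 2 * e2 ^+ 2 * x3)
         (e2 ^+ 2 * (e1 * q1)) (e1 ^+ 2 * (e2 * q2)) (e1 * e2 * q3).
  by apply/val_inj/matrixP; do 2![apply: ord3P];
    rewrite !mxE /= !big_ord3 !mxE !big_ord3 !mxE /=; ring.
rewrite /slice_of /slice_pt /diag_congr /= !act E1 E2 !mul1r !mulr0.
by congr (_, sym6 _ _ _ _ _ _); ring.
Qed.

Lemma slice_action_fvec g : slice_action g ->
  forall s, fvec (slice_of (g s)) = fvec (slice_of s).
Proof. by move=> gP s; have [m dm ->] := gP s; rewrite fvec_congr. Qed.

Lemma slice_action_f11 g : slice_action g ->
  forall s, f11 (slice_of (g s)) = f11 (slice_of s).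
Proof. by move=> gP s; have [m dm ->] := gP s; rewrite f11_congr. Qed.

Lemma local_B_srot (c : S -> K) : local_B c -> forall s, c (srot s) = c s.
Proof. exact/local_B_act/slice_action_fvec/slice_of_srot. Qed.

Lemma local_B_sswap (c : S -> K) : local_B c -> forall s, c (sswap s) = c s.
Proof. exact/local_B_act/slice_action_fvec/slice_of_sswap. Qed.

Local Notation adjoin_y A := (adjoin3 (@sy1 K) (@sy2 K) (@sy3 K) A).

Section OverA.
Variable A : (S -> K) -> Prop.
Hypotheses (algA : function_algebra A) (sub0 : forall c, local_B c -> A c).
Hypotheses (invR : forall c, A c -> forall s, c (srot s) = c s)
           (invS : forall c, A c -> forall s, c (sswap s) = c s).

Definition sum6 h s := h s + h (srot s) + h (srot (srot s)) + h (sswap s)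
  + h (srot (sswap s)) + h (srot (srot (sswap s))).

Lemma adjoin3_sum6 h : adjoin_y A h -> A (sum6 h).
Proof.
elim=> [c n1 n2 n3 Ac|F G _ IHF _ IHG]; last first.
  rewrite (_ : sum6 _ = fun s => sum6 F s + sum6 G s); first exact: algD.
  by apply/funext => s; rewrite /sum6; ring.
have [[/sub0 A1 /sub0 A2 /sub0 A3] _ _] := local_B_coefs K.
have := sym_sum_alg algA A1 A2 A3 n1 n2 n3.
move/(algM algA Ac); congr A; apply/funext => s.
by rewrite /sum6 !(invR Ac, invS Ac) /=; ring.
Qed.

(** An invariant function is the average of its translates, and the average of
    a polynomial in the y_i is a symmetric polynomial in the y_i. *)
Lemma adjoin3_inv h :
  (forall s, h (srot s) = h s) -> (forall s, h (sswap s) = h s) ->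
  adjoin_y A h -> A h.
Proof.
move=> hR hS ah; have := adjoin3_sum6 ah.
move/(algM algA (algC algA 6^-1)); congr A; apply/funext => s.
by rewrite /sum6 !(hR, hS); field.
Qed.

End OverA.

Section Solve.
Variable A : (S -> K) -> Prop.
Hypotheses (algA : function_algebra A) (sub0 : forall c, local_B c -> A c).
Let algY := adjoin3_alg (@sy1 K) (@sy2 K) (@sy3 K) algA.

Lemma adjoin_local_B c : local_B c -> adjoin_y A c.
Proof. by move=> /sub0; apply: adjoin3_base. Qed.

Lemma adjoin_y123 :
  [/\ adjoin_y A (@sy1 K), adjoin_y A (@sy2 K) & adjoin_y A (@sy3 K)].
Proof. exact: adjoin3_vars. Qed.

(** The product (y1 - y2) (y1 - y3) divides the square of the Vandermonde
    determinant, which is invertible. *)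
Lemma adjoin_div h :
  [/\ adjoin_y A (fun s => h s * ((sy1 s - sy2 s) * (sy1 s - sy3 s))) ->
        adjoin_y A h,
      adjoin_y A (fun s => h s * ((sy2 s - sy1 s) * (sy2 s - sy3 s))) ->
        adjoin_y A h
    & adjoin_y A (fun s => h s * ((sy3 s - sy1 s) * (sy3 s - sy2 s))) ->
        adjoin_y A h].
Proof.
have iv := adjoin_local_B (local_B_vdm K).
have [h1 h2 h3] := adjoin_y123.
have v0 := @svandermonde_neq0 K.
split=> ah.
- have -> : h = fun s => (h s * ((sy1 s - sy2 s) * (sy1 s - sy3 s))) *
    ((vandermonde3 (sy1 s) (sy2 s) (sy3 s) ^+ 2)^-1 *
     ((sy1 s + - sy2 s) * (sy1 s + - sy3 s) * (sy2 s + - sy3 s) ^+ 2)).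
    apply/funext => s; have := v0 s; rewrite /vandermonde3 => ?; field.
    by rewrite sy12 sy13 sy23.
  by in_algebra algY.
- have -> : h = fun s => (h s * ((sy2 s - sy1 s) * (sy2 s - sy3 s))) *
    ((vandermonde3 (sy1 s) (sy2 s) (sy3 s) ^+ 2)^-1 *
     ((sy2 s + - sy1 s) * (sy2 s + - sy3 s) * (sy1 s + - sy3 s) ^+ 2)).
    apply/funext => s; have := v0 s; rewrite /vandermonde3 => ?; field.
    by rewrite sy12 sy13 sy23.
  by in_algebra algY.
- have -> : h = fun s => (h s * ((sy3 s - sy1 s) * (sy3 s - sy2 s))) *
    ((vandermonde3 (sy1 s) (sy2 s) (sy3 s) ^+ 2)^-1 *
     ((sy3 s + - sy1 s) * (sy3 s + - sy2 s) * (sy1 s + - sy2 s) ^+ 2)).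
    apply/funext => s; have := v0 s; rewrite /vandermonde3 => ?; field.
    by rewrite sy12 sy13 sy23.
  by in_algebra algY.
Qed.

Lemma adjoin_a :
  [/\ adjoin_y A (@sa1 K), adjoin_y A (@sa2 K) & adjoin_y A (@sa3 K)].
Proof.
have [h1 h2 h3] := adjoin_y123.
have [_ [/adjoin_local_B t0 /adjoin_local_B t1 /adjoin_local_B t2] _] :=
  local_B_coefs K.
split.
- have [div _ _] := adjoin_div (@sa1 K); apply: div.
  rewrite (_ : (fun s => _) =
      fun s => sy1 s ^+ 2 * sT0 s + - (sy1 s * sT2 s) + sT1 s).
    by in_algebra algY.
  by apply/funext => s; rewrite /sT0 /sT1 /sT2; ring.
- have [_ div _] := adjoin_div (@sa2 K); apply: div.
  rewrite (_ : (fun s => _) =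
      fun s => sy2 s ^+ 2 * sT0 s + - (sy2 s * sT2 s) + sT1 s).
    by in_algebra algY.
  by apply/funext => s; rewrite /sT0 /sT1 /sT2; ring.
- have [_ _ div] := adjoin_div (@sa3 K); apply: div.
  rewrite (_ : (fun s => _) =
      fun s => sy3 s ^+ 2 * sT0 s + - (sy3 s * sT2 s) + sT1 s).
    by in_algebra algY.
  by apply/funext => s; rewrite /sT0 /sT1 /sT2; ring.
Qed.

Lemma adjoin_b : A (@sphi K) ->
  [/\ adjoin_y A (@sb1 K), adjoin_y A (@sb2 K) & adjoin_y A (@sb3 K)].
Proof.
move=> /(adjoin3_base (@sy1 K) (@sy2 K) (@sy3 K)) hp.
have [h1 h2 h3] := adjoin_y123.
have [_ _ [/adjoin_local_B t0 /adjoin_local_B t1 _]] := local_B_coefs K.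
split.
- have [div _ _] := adjoin_div (@sb1 K); apply: div.
  rewrite (_ : (fun s => _) =
      fun s => sy1 s * sB1 s + sy2 s * sy3 s * sB0 s + - sphi s).
    by in_algebra algY.
  by apply/funext => s; rewrite /sB0 /sB1 /sphi; ring.
- have [_ div _] := adjoin_div (@sb2 K); apply: div.
  rewrite (_ : (fun s => _) =
      fun s => sy2 s * sB1 s + sy1 s * sy3 s * sB0 s + - sphi s).
    by in_algebra algY.
  by apply/funext => s; rewrite /sB0 /sB1 /sphi; ring.
- have [_ _ div] := adjoin_div (@sb3 K); apply: div.
  rewrite (_ : (fun s => _) =
      fun s => sy3 s * sB1 s + sy1 s * sy2 s * sB0 s + - sphi s).
    by in_algebra algY.
  by apply/funext => s; rewrite /sB0 /sB1 /sphi; ring.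
Qed.

End Solve.
End Reynolds.

(** * Restrictions of invariants to the slice *)

Section SliceInvariants.
Variable K : numClosedFieldType.
Local Notation V := (sym_matrix K 3).
Local Notation S := (slice_param K).
Local Notation adjoin_y A := (adjoin3 (@sy1 K) (@sy2 K) (@sy3 K) A).
Implicit Types (s : S) (h c : S -> K).

Definition scub2 s := cub2 (sy1 s) (sy2 s) (sy3 s) (sa1 s) (sa2 s) (sa3 s)
  (sB0 s) (sB1 s).
Definition scub1 s := cub1 (sy1 s) (sy2 s) (sy3 s) (sa1 s) (sa2 s) (sa3 s)
  (sB0 s) (sB1 s) (sd s).
Definition scub0 s := cub0 (sy1 s) (sy2 s) (sy3 s) (sa1 s) (sa2 s) (sa3 s)
  (sB0 s) (sB1 s) (sd s).

(** The coefficients are visibly polynomials in the y_i over B[1/E].  They are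
    symmetric because a permutation permutes the three factors phi + kappa_i
    and changes lin0 + lin1 phi at most by a sign. *)
Lemma local_B_cubic : [/\ local_B scub2, local_B scub1 & local_B scub0].
Proof.
have algA := local_B_alg K.
have algY := adjoin3_alg (@sy1 K) (@sy2 K) (@sy3 K) algA.
have sub0 : forall c, local_B c -> local_B c by [].
have [h1 h2 h3] := adjoin_y123 algA.
have [g1 g2 g3] := adjoin_a algA sub0.
have [_ _ [B0 B1 D]] := local_B_coefs K.
have b0 := adjoin_local_B sub0 B0.
have b1 := adjoin_local_B sub0 B1.
have d := adjoin_local_B sub0 D.
have B0R := local_B_srot B0; have B0S := local_B_sswap B0.
have B1R := local_B_srot B1; have B1S := local_B_sswap B1.
have DR := local_B_srot D; have DS := local_B_sswap D.
split; apply: (adjoin3_inv algA sub0 (@local_B_srot K) (@local_B_sswap K))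
  => [s|s|].
- by rewrite /scub2 B0R B1R /cub2 /lin1 /kappa /=; field.
- by rewrite /scub2 B0S B1S /cub2 /lin1 /kappa /=; field.
- by rewrite /scub2 /cub2 /lin1 /kappa; in_algebra algY.
- by rewrite /scub1 B0R B1R DR /cub1 /lin1 /lin0 /kappa /vandermonde3 /=; field.
- by rewrite /scub1 B0S B1S DS /cub1 /lin1 /lin0 /kappa /vandermonde3 /=; field.
- by rewrite /scub1 /cub1 /lin1 /lin0 /kappa /vandermonde3; in_algebra algY.
- by rewrite /scub0 B0R B1R DR /cub0 /lin0 /kappa /vandermonde3 /=; field.
- by rewrite /scub0 B0S B1S DS /cub0 /lin0 /kappa /vandermonde3 /=; field.
- by rewrite /scub0 /cub0 /lin0 /kappa /vandermonde3; in_algebra algY.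
Qed.

(** The functions on the slice induced by M[1/E]. *)
Definition local_M h := exists c : 'I_3 -> S -> K, (forall i, local_B (c i)) /\
  forall s, h s = c i0 s + c i1 s * sphi s + c i2 s * sphi s ^+ 2.

Lemma local_M_intro c0 c1 c2 h : local_B c0 -> local_B c1 -> local_B c2 ->
  (forall s, h s = c0 s + c1 s * sphi s + c2 s * sphi s ^+ 2) -> local_M h.
Proof.
move=> l0 l1 l2 hE; exists (fun i => nth c0 [:: c0; c1; c2] i); split=> //.
by apply: ord3P.
Qed.

Lemma local_B_M h : local_B h -> local_M h.
Proof.
have lz := algC (local_B_alg K) 0.
by move=> lh; apply: (local_M_intro lh lz lz) => s; rewrite !mul0r !addr0.
Qed.

Lemma local_M_sphi : local_M (@sphi K).
Proof.
have alg0 := local_B_alg K.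
apply: (local_M_intro (algC alg0 0) (algC alg0 1) (algC alg0 0)) => s.
by rewrite add0r mul1r mul0r addr0.
Qed.

Lemma sphi_cubic s :
  sphi s ^+ 3 = - (scub2 s * sphi s ^+ 2 + scub1 s * sphi s + scub0 s).
Proof. exact: cubic_relation. Qed.

Lemma local_M_alg : function_algebra local_M.
Proof.
have alg0 := local_B_alg K; have [k2 k1 k0] := local_B_cubic.
split=> [c|F G [f [fl fE]] [g [gl gE]]|F G [f [fl fE]] [g [gl gE]]].
- exact/local_B_M/(algC alg0).
- apply: (local_M_intro (c0 := fun s => f i0 s + g i0 s)
    (c1 := fun s => f i1 s + g i1 s) (c2 := fun s => f i2 s + g i2 s));
    try exact: algD.
  by move=> s; rewrite fE gE; ring.
have [f0 f1 f2] := And3 (fl i0) (fl i1) (fl i2).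
have [g0 g1 g2] := And3 (gl i0) (gl i1) (gl i2).
(* e3 and e4 are the coefficients of phi^3 and phi^4 in the product; replacing
   phi^4 first adds - e4 * scub2 to the coefficient of phi^3 *)
pose e3 s := f i1 s * g i2 s + f i2 s * g i1 s.
pose e4 s := f i2 s * g i2 s.
pose e3' s := e3 s + - (e4 s * scub2 s).
have l4 : local_B e4 by apply: (algM alg0).
have l3' : local_B e3' by rewrite /e3' /e3; in_algebra alg0.
apply: (local_M_intro
   (c0 := fun s => f i0 s * g i0 s + - (e3' s * scub0 s))
   (c1 := fun s => f i0 s * g i1 s + f i1 s * g i0 s + - (e3' s * scub1 s)
            + - (e4 s * scub0 s))
   (c2 := fun s => f i0 s * g i2 s + f i1 s * g i1 s + f i2 s * g i0 s
            + - (e3' s * scub2 s) + - (e4 s * scub1 s)));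
  try by in_algebra alg0.
move=> s; rewrite fE gE.
transitivity (f i0 s * g i0 s + (f i0 s * g i1 s + f i1 s * g i0 s) * sphi s
  + (f i0 s * g i2 s + f i1 s * g i1 s + f i2 s * g i0 s) * sphi s ^+ 2
  + (e3 s + e4 s * sphi s) * sphi s ^+ 3); first by rewrite /e3 /e4; ring.
have c4 : e4 s * sphi s * sphi s ^+ 3 = e4 s * (- scub2 s * sphi s ^+ 3
    - scub1 s * sphi s ^+ 2 - scub0 s * sphi s).
  by rewrite {1}sphi_cubic; ring.
by rewrite [X in _ + X]mulrDl c4 sphi_cubic /e3'; ring.
Qed.

Lemma sphi_f11 s : f11 (slice_of s) = (sl s ^+ 3) ^+ 2 * sphi s.
Proof. by rewrite f11_slice -exprM. Qed.

Lemma local_M_act g h : slice_action g -> local_M h -> forall s, h (g s) = h s.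
Proof.
move=> gP [c [cl hE]] s.
have c0 i : c i (g s) = c i s.
  by apply: local_B_act (cl i) s; apply: slice_action_fvec.
have l3 : sl (g s) ^+ 3 = sl s ^+ 3 :=
  local_B_act (slice_action_fvec gP) (local_B_l3 K) s.
have phiE : sphi (g s) = sphi s.
  have l3n0 : (sl s ^+ 3) ^+ 2 != 0 := expf_neq0 _ (expf_neq0 _ (sl_neq0 s)).
  by apply: (mulfI l3n0); rewrite -sphi_f11 -(slice_action_f11 gP) sphi_f11 l3.
by rewrite !hE !c0 phiE.
Qed.

Lemma adjoin_act (g : S -> S) h : slice_action g ->
  (forall s, [/\ sy1 (g s) = sy1 s, sy2 (g s) = sy2 s & sy3 (g s) = sy3 s]) ->
  adjoin_y local_M h -> forall s, h (g s) = h s.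
Proof.
move=> gP gy; elim=> [c n1 n2 n3 Ac|F G _ IHF _ IHG] s; last by rewrite IHF IHG.
by have [-> -> ->] := gy s; rewrite (local_M_act gP).
Qed.

(** Polynomials in l, p1, p2, p3 over M[1/E][y1, y2, y3]. *)
Inductive slice_poly : (S -> K) -> Prop :=
| SlicePoly_gen g n0 n1 n2 n3 : adjoin_y local_M g -> slice_poly
    (fun s => g s * (sl s ^+ n0 * sp1 s ^+ n1 * sp2 s ^+ n2 * sp3 s ^+ n3))
| SlicePoly_add F G :
    slice_poly F -> slice_poly G -> slice_poly (fun s => F s + G s).

Let algY := adjoin3_alg (@sy1 K) (@sy2 K) (@sy3 K) local_M_alg.

Lemma slice_poly_base g : adjoin_y local_M g -> slice_poly g.
Proof.
move=> ag; have := SlicePoly_gen 0 0 0 0 ag.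
by congr slice_poly; apply/funext => s; rewrite !expr0 !mulr1.
Qed.

Lemma slice_poly_alg : function_algebra slice_poly.
Proof.
split; first by move=> c; apply: slice_poly_base; apply: algC.
  exact: SlicePoly_add.
move=> F G AF; elim: AF G => [g n0 n1 n2 n3 Ag|F1 F2 _ IH1 _ IH2] G AG; last first.
  by under eq_fun do rewrite mulrDl; apply: SlicePoly_add; [apply: IH1 | apply: IH2].
elim: AG => [d m0 m1 m2 m3 Ad|G1 G2 _ IH1 _ IH2]; last first.
  by under eq_fun do rewrite mulrDr; apply: SlicePoly_add.
rewrite (_ : (fun s => _) = (fun s => (g s * d s) * (sl s ^+ (n0 + m0) *
  sp1 s ^+ (n1 + m1) * sp2 s ^+ (n2 + m2) * sp3 s ^+ (n3 + m3)))).
  by apply: SlicePoly_gen; apply: algM.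
by apply/funext => s; rewrite !exprD; ring.
Qed.

Lemma slice_poly_coords :
  [/\ slice_poly (@sl K), slice_poly (@sp1 K), slice_poly (@sp2 K)
    & slice_poly (@sp3 K)].
Proof.
split.
- have := SlicePoly_gen 1 0 0 0 (algC algY 1).
  by congr slice_poly; apply/funext => s; ring.
- have := SlicePoly_gen 0 1 0 0 (algC algY 1).
  by congr slice_poly; apply/funext => s; ring.
- have := SlicePoly_gen 0 0 1 0 (algC algY 1).
  by congr slice_poly; apply/funext => s; ring.
- have := SlicePoly_gen 0 0 0 1 (algC algY 1).
  by congr slice_poly; apply/funext => s; ring.
Qed.

Lemma alg_scalar_sym6 (A : (S -> K) -> Prop) (f : {linear V -> K | *%R})
    a1 a2 a3 p1 p2 p3 :
  function_algebra A -> A a1 -> A a2 -> A a3 -> A p1 -> A p2 -> A p3 ->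
  A (fun s => f (sym6 (a1 s) (a2 s) (a3 s) (p1 s) (p2 s) (p3 s))).
Proof.
move=> algA A1 A2 A3 P1 P2 P3.
under eq_fun do rewrite sym6_basis !linearD !linearZ /=.
by in_algebra algA.
Qed.

Lemma polyfun_slice_poly P :
  polynomial_function P -> slice_poly (P \o @slice_of K).
Proof.
have algA := slice_poly_alg.
case=> n [f [p ->]].
apply: (alg_meval algA p (h := fun i s => f i (slice_of s))) => i.
have lin1 : linear_for *%R (fun x : V => f i (x, 0, 0)).
  move=> a u w.
  have -> : (a *: u + w, 0, 0) = a *: (u, 0, 0) + (w, 0, 0) :> V * V * V.
    by do 2?[apply: (congr2 pair)]; rewrite /= ?scaler0 ?addr0.
  by rewrite linearP.
have lin2 : linear_for *%R (fun x : V => f i (0, x, 0)).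
  move=> a u w.
  have -> : (0, a *: u + w, 0) = a *: (0, u, 0) + (0, w, 0) :> V * V * V.
    by do 2?[apply: (congr2 pair)]; rewrite /= ?scaler0 ?addr0.
  by rewrite linearP.
have lin3 : linear_for *%R (fun x : V => f i (0, 0, x)).
  move=> a u w.
  have -> : (0, 0, a *: u + w) = a *: (0, 0, u) + (0, 0, w) :> V * V * V.
    by do 2?[apply: (congr2 pair)]; rewrite /= ?scaler0 ?addr0.
  by rewrite linearP.
pose f1 : {linear V -> K | *%R} := HB.pack (fun x : V => f i (x, 0, 0))
  (GRing.isLinear.Build K V K *%R _ lin1).
pose f2 : {linear V -> K | *%R} := HB.pack (fun x : V => f i (0, x, 0))
  (GRing.isLinear.Build K V K *%R _ lin2).
pose f3 : {linear V -> K | *%R} := HB.pack (fun x : V => f i (0, 0, x))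
  (GRing.isLinear.Build K V K *%R _ lin3).
have -> : (fun s => f i (slice_of s)) =
    fun s => f1 (slice_of s).1.1 + f2 (slice_of s).1.2 + f3 (slice_of s).2.
  apply/funext => s; rewrite /f1 /f2 /f3 /= -!linearD; congr (f i _).
  by do 2?[apply: (congr2 pair)]; rewrite /= ?add0r ?addr0.
have [l1 p1 p2 p3] := slice_poly_coords.
have [/slice_poly_base y1 /slice_poly_base y2 /slice_poly_base y3] :=
  adjoin_y123 local_M_alg.
have [/slice_poly_base a1 /slice_poly_base a2 /slice_poly_base a3] :=
  adjoin_a local_M_alg local_B_M.
have z0 := algC algA 0.
apply: (algD algA); first apply: (algD algA).
- by apply: alg_scalar_sym6.
- by apply: alg_scalar_sym6 => //; apply: (algM algA).
- by apply: alg_scalar_sym6 => //; apply: (algM algA).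
Qed.

Lemma exists_omega : exists2 w : K, w != 0 & w ^+ 2 + w + 1 = 0.
Proof.
have [w wE] := @GRing.solve_monicpoly K 2 (fun=> -1) isT.
have wE' : w ^+ 2 + w + 1 = 0.
  by rewrite wE !big_ord_recl big_ord0 /= /bump /=; ring.
exists w => //; apply/eqP => w0; move: wE'; rewrite w0 expr0n /= !add0r => /eqP.
by rewrite oner_eq0.
Qed.

Lemma adjoin_even_monomial :
  [/\ adjoin_y local_M (fun s => sp1 s ^+ 2),
      adjoin_y local_M (fun s => sp2 s ^+ 2),
      adjoin_y local_M (fun s => sp3 s ^+ 2)
    & adjoin_y local_M (fun s => sp1 s * sp2 s * sp3 s)].
Proof.
have [g1 g2 g3] := adjoin_a local_M_alg local_B_M.
have [b1 b2 b3] := adjoin_b local_M_alg local_B_M local_M_sphi.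
have [_ _ [_ _ /(adjoin_local_B local_B_M) d]] := local_B_coefs K.
have q1 : adjoin_y local_M (fun s => sp1 s ^+ 2).
  rewrite (_ : (fun s => _) = fun s => sa2 s * sa3 s + - sb1 s).
    by in_algebra algY.
  by apply/funext => s; rewrite /sb1; ring.
have q2 : adjoin_y local_M (fun s => sp2 s ^+ 2).
  rewrite (_ : (fun s => _) = fun s => sa1 s * sa3 s + - sb2 s).
    by in_algebra algY.
  by apply/funext => s; rewrite /sb2; ring.
have q3 : adjoin_y local_M (fun s => sp3 s ^+ 2).
  rewrite (_ : (fun s => _) = fun s => sa1 s * sa2 s + - sb3 s).
    by in_algebra algY.
  by apply/funext => s; rewrite /sb3; ring.
split=> //.
rewrite (_ : (fun s => _) = fun s => 2^-1 * (sd s + - (sa1 s * sa2 s * sa3 s)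
   + sa1 s * sp1 s ^+ 2 + sa2 s * sp2 s ^+ 2 + sa3 s * sp3 s ^+ 2)).
  by in_algebra algY.
by apply/funext => s; rewrite /sd; field.
Qed.

Lemma adjoin_parity_monomial (b : bool) m1 m2 m3 :
  adjoin_y local_M (fun s => sp1 s ^+ (b + m1.*2) * sp2 s ^+ (b + m2.*2)
                             * sp3 s ^+ (b + m3.*2)).
Proof.
have [q1 q2 q3 u] := adjoin_even_monomial.
rewrite (_ : (fun s => _) = fun s => (sp1 s * sp2 s * sp3 s) ^+ b *
   ((sp1 s ^+ 2) ^+ m1 * (sp2 s ^+ 2) ^+ m2 * (sp3 s ^+ 2) ^+ m3)).
  by in_algebra algY.
by apply/funext => s; rewrite !exprD -!exprM !mul2n !exprMn; ring.
Qed.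

Section Average.
Variables (w : K) (w0 : w != 0) (wE : w ^+ 2 + w + 1 = 0).

Lemma omega_cube : w ^+ 3 = 1.
Proof.
have -> : w ^+ 3 = (w - 1) * (w ^+ 2 + w + 1) + 1 by ring.
by rewrite wE mulr0 add0r.
Qed.

Definition sum4 h s := h s + h (ssign 1 (-1) (-1) s) + h (ssign (-1) 1 (-1) s)
  + h (ssign (-1) (-1) 1 s).

Definition sum3 h s := h s + h (sscale w0 s) + h (sscale w0 (sscale w0 s)).

(** The sum over the twelve translates multiplies a monomial in l and the p_i
    by a constant, which vanishes unless the exponent of l is a multiple of 3
    and those of the p_i have the same parity; the remaining monomials are in
    M[1/E][y1, y2, y3]. *)
Lemma slice_poly_sum h : slice_poly h -> adjoin_y local_M (sum3 (sum4 h)).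
Proof.
elim=> [g n0 n1 n2 n3 Ag|F G _ IHF _ IHG]; last first.
  rewrite (_ : sum3 _ = fun s => sum3 (sum4 F) s + sum3 (sum4 G) s).
    exact: (algD algY).
  by apply/funext => s; rewrite /sum3 /sum4; ring.
have gw s : g (sscale w0 s) = g s.
  by apply: (adjoin_act _ _ Ag) => //; apply/slice_of_sscale/omega_cube.
have gs e1 e2 e3 : e1 ^+ 2 = 1 -> e2 ^+ 2 = 1 -> e3 = e1 * e2 ->
    forall s, g (ssign e1 e2 e3 s) = g s.
  move=> E1 E2 E3 s.
  by apply: (adjoin_act _ _ Ag) => //; apply: slice_of_ssign.
have gs1 := gs 1 (-1) (-1) (expr1n _ _) (sqrr_sign _ 1) (esym (mul1r _)).
have gs2 := gs (-1) 1 (-1) (sqrr_sign _ 1) (expr1n _ _) (esym (mulr1 _)).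
have gs3 := gs (-1) (-1) 1 (sqrr_sign _ 1) (sqrr_sign _ 1).
rewrite mulrNN mulr1 in gs3; move: gs3 => /(_ erefl) gs3.
pose cw : K := 1 + w ^+ n0 + w ^+ n0 * w ^+ n0.
pose e n : K := (-1) ^+ n.
pose cs : K := 1 + e n2 * e n3 + e n1 * e n3 + e n1 * e n2.
rewrite (_ : sum3 _ = fun s => cw * cs * g s *
  (sl s ^+ n0 * (sp1 s ^+ n1 * sp2 s ^+ n2 * sp3 s ^+ n3))); last first.
  apply/funext => s; rewrite /sum3 /sum4 !(gs1, gs2, gs3, gw) /= /cw /cs /e.
  by rewrite !mul1r !(exprMn _ (-1)) !(exprMn _ w); ring.
have n0E := divn_eq n0 3.
have wn0 : w ^+ n0 = w ^+ (n0 %% 3).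
  by rewrite {1}n0E exprD mulnC exprM omega_cube expr1n mul1r.
have [r0|r0] := eqVneq (n0 %% 3)%N 0%N; last first.
  have cw0 : cw = 0.
    rewrite /cw wn0; move: r0 (ltn_pmod n0 (isT : 0 < 3)%N).
    case: (n0 %% 3)%N => [|[|[|]]] // _ _; rewrite -[RHS]wE ?expr1.
      by ring.
    by rewrite -exprD (exprD w 3 1) omega_cube; ring.
  by under eq_fun do rewrite cw0 !mul0r; exact: (algC algY).
have lA : adjoin_y local_M (fun s => sl s ^+ n0).
  rewrite (_ : (fun s => _) = fun s => (sl s ^+ 3) ^+ (n0 %/ 3)).
    by apply: (algX algY); apply: adjoin3_base; apply/local_B_M/local_B_l3.
  by apply/funext => s; rewrite -exprM mulnC {1}n0E r0 addn0.
have [par|par] := boolP ((odd n1 == odd n2) && (odd n1 == odd n3)); last first.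
  have cs0 : cs = 0.
    rewrite /cs /e -(signr_odd _ n1) -(signr_odd _ n2) -(signr_odd _ n3).
    by case: (odd n1) (odd n2) (odd n3) par => [] [] [] //= _;
      rewrite ?expr0 ?expr1; ring.
  by under eq_fun do rewrite cs0 mulr0 !mul0r; exact: (algC algY).
move: par => /andP[/eqP p2 /eqP p3].
apply: (algM algY); first by apply: (algM algY) => //; exact: (algC algY).
apply: (algM algY) => //.
have := adjoin_parity_monomial (odd n1) n1./2 n2./2 n3./2.
by rewrite {2}p2 {2}p3 !odd_double_half.
Qed.

End Average.

Theorem slice_invariant P : invariants3 P -> local_M (P \o @slice_of K).
Proof.
move=> [Ppf Pinv].
have [w w0 wE] := exists_omega.
have inv (g : S -> S) : slice_action g ->
    forall s, P (slice_of (g s)) = P (slice_of s).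
  by move=> gP s; have [m dm ->] := gP s; rewrite Pinv.
apply: (adjoin3_inv local_M_alg local_B_M).
- by move=> c; apply/local_M_act/slice_of_srot.
- by move=> c; apply/local_M_act/slice_of_sswap.
- exact/inv/slice_of_srot.
- exact/inv/slice_of_sswap.
have := slice_poly_sum w0 wE (polyfun_slice_poly Ppf).
move/(algM algY (algC algY 12^-1)); congr adjoin3; apply/funext => s.
have invw t : P (slice_of (sscale w0 t)) = P (slice_of t).
  exact/(inv (sscale w0))/slice_of_sscale/omega_cube.
have invs e1 e2 e3 t : e1 ^+ 2 = 1 -> e2 ^+ 2 = 1 -> e3 = e1 * e2 ->
    P (slice_of (ssign e1 e2 e3 t)) = P (slice_of t).
  by move=> E1 E2 E3; apply/(inv (ssign e1 e2 e3))/slice_of_ssign.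
have N2 : (-1) ^+ 2 = 1 :> K by rewrite sqrrN expr1n.
rewrite /sum3 /sum4 /= !(invs 1) ?(invs (-1)) ?N2 ?expr1n ?mul1r ?mulr1
  ?mulrNN ?mulr1 // !invw.
by field.
Qed.

End SliceInvariants.

(** * Reduction to the slice *)

Section NormalForm.
Variable K : numClosedFieldType.
Local Notation V := (sym_matrix K 3).
Local Notation X k := ('X_(@Ordinal 10 k isT)).
Implicit Types (s : slice_param K) (v : V * V * V).

Lemma cubic_split (A B C : K) : exists r1 r2 r3,
  [/\ A = - (r1 + r2 + r3), B = r1 * r2 + r1 * r3 + r2 * r3
    & C = - (r1 * r2 * r3)].
Proof.
have [r1 r1E] :=
  @GRing.solve_monicpoly K 3 (nth 0 [:: - C; - B; - A]) isT.
have {}r1E : C = - (r1 ^+ 3 + A * r1 ^+ 2 + B * r1).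
  by rewrite r1E !big_ord_recl big_ord0 /= /bump /=; ring.
have [r2 r2E] := @GRing.solve_monicpoly K 2
  (nth 0 [:: - (B + r1 * (A + r1)); - (A + r1)]) isT.
have {}r2E : B = - (r2 ^+ 2 + (A + r1) * r2 + r1 * (A + r1)).
  by rewrite r2E !big_ord_recl big_ord0 /= /bump /=; ring.
by exists r1, r2, (- (A + r1) - r2); split; rewrite ?r1E ?r2E; ring.
Qed.

(** For distinct roots e_i of det (y - t x), kernel vectors u_i of y - e_i x
    are orthogonal for x and for y.  They are linearly independent, hence not
    isotropic for x, and can be rescaled by square roots. *)
Lemma congr_diag (x y : 'M[K]_3) (e : 'I_3 -> K) :
  x^T = x -> y^T = y -> \det x != 0 -> injective e ->
  (forall i, \det (y - e i *: x) = 0) ->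
  exists g : 'M[K]_3, [/\ \det g != 0, g *m x *m g^T = 1%:M &
     g *m y *m g^T = diag_mx (\row_i e i)].
Proof.
move=> xT yT dx inj_e sing.
pose D := diag_mx (\row_i e i).
have exu i : exists u : 'rV[K]_3, u != 0 /\ u *m y = e i *: (u *m x).
  have /eqP/det0P[u u0 uE] := sing i; exists u; split=> //.
  by apply/eqP; rewrite -subr_eq0 scalemxAr -mulmxBr uE.
have [u uP] := choice exu.
pose G := \matrix_i u i.
have GE : G *m y = D *m G *m x.
  apply/row_matrixP => i; rewrite row_mul rowK (uP i).2 -mulmxA row_mul.
  by rewrite row_diag_mx mxE -scalemxAl -rowE row_mul rowK.
have xU : x \in unitmx by rewrite unitmxE unitfE.
have GU : \det G != 0.
  apply/negP => /det0P[c c0 cG].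
  (* the left kernel of G is stable under D, hence contains the coordinate
     vectors that are isolated from c by the factors D - e_j *)
  have cD (c' : 'rV_3) a : c' *m G = 0 -> (c' *m (D - a%:M)) *m G = 0.
    move=> cG'.
    rewrite mulmxBr mulmxBl mul_mx_scalar -scalemxAl cG' scaler0 subr0.
    have /(congr1 (mulmx^~ (invmx x))) : c' *m D *m G *m x = 0.
      by rewrite -!mulmxA [D *m _]mulmxA -GE mulmxA cG' mul0mx.
    by rewrite mulmxK // mul0mx.
  have ci i j k : i != j -> i != k ->
      (forall l, [|| l == i, l == j | l == k]) -> c 0 i = 0.
    move=> ij ik ijk.
    have := cD _ (e k) (cD _ (e j) cG).
    have -> : c *m (D - (e j)%:M) *m (D - (e k)%:M) =
        (c 0 i * (e i - e j) * (e i - e k)) *: delta_mx 0 i.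
      have DE a : D - a%:M = diag_mx (\row_i (e i - a)).
        by apply/matrixP => r t; rewrite !mxE -mulrnBl.
      rewrite !DE; apply/rowP => l; rewrite !mul_mx_diag !mxE /=.
      have /or3P[/eqP->|/eqP->|/eqP->] := ijk l; first by rewrite eqxx mulr1.
        by rewrite subrr mulr0 mul0r eq_sym (negbTE ij) mulr0.
      by rewrite subrr mulr0 eq_sym (negbTE ik) mulr0.
    rewrite -scalemxAl -rowE rowK => /eqP.
    rewrite scaler_eq0 (negbTE (uP i).1) orbF !mulf_eq0 !subr_eq0.
    by rewrite !(inj_eq inj_e) (negbTE ij) (negbTE ik) !orbF => /eqP.
  move/eqP: c0; apply; apply/rowP; apply: ord3P; rewrite mxE.
  - by apply: (ci _ i1 i2) => //; apply: ord3P.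
  - by apply: (ci _ i0 i2) => //; apply: ord3P.
  - by apply: (ci _ i0 i1) => //; apply: ord3P.
pose M := G *m x *m G^T.
have MdefE : G *m x *m G^T = M by [].
have MT : M^T = M by rewrite /M !trmx_mul trmxK xT mulmxA.
have DM : G *m y *m G^T = D *m M by rewrite GE /M !mulmxA.
have DMC : D *m M = M *m D.
  rewrite -[RHS]trmxK [in RHS]trmx_mul tr_diag_mx MT -/D -DM.
  by rewrite !trmx_mul trmxK yT mulmxA.
have Mdiag i j : i != j -> M i j = 0.
  move=> ij; have /matrixP/(_ i j) := DMC.
  rewrite mul_diag_mx mul_mx_diag !mxE mulrC => /eqP.
  rewrite -subr_eq0 -mulrBr mulf_eq0 subr_eq0 (inj_eq inj_e) (negbTE ij) orbF.
  by rewrite -[in _ == _]/(M i j) => /eqP.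
have ME : M = diag_mx (\row_i M i i).
  apply/matrixP => i j; rewrite [RHS]mxE.
  have [->|ij] := eqVneq i j; first by rewrite mulr1n [RHS]mxE.
  by rewrite mulr0n Mdiag.
have Mnz i : M i i != 0.
  have : \det M != 0 by rewrite !det_mulmx det_tr !mulf_neq0.
  rewrite {1}ME det_diag; apply: contraNneq => Mi0.
  by rewrite (bigD1 i) //= mxE Mi0 mul0r.
clearbody M.
pose q i := (sqrtC (M i i))^-1.
have qM i : q i * M i i * q i = 1.
  by rewrite /q -{2}[M i i]sqrtCK expr2; field; rewrite sqrtC_eq0.
pose Q := diag_mx (\row_i q i).
exists (Q *m G); split.
- rewrite det_mulmx mulf_neq0 // det_diag; apply/prodf_neq0 => i _.
  by rewrite mxE invr_eq0 sqrtC_eq0.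
- have -> : Q *m G *m x *m (Q *m G)^T = Q *m M *m Q.
    by rewrite trmx_mul tr_diag_mx -MdefE !mulmxA.
  rewrite ME; apply/matrixP => i j; rewrite mul_diag_mx mul_mx_diag !mxE.
  have [->|_] := eqVneq i j; last by rewrite !mulr0n mulr0 mul0r.
  by rewrite !mulr1n qM.
- have -> : Q *m G *m y *m (Q *m G)^T = Q *m (D *m M) *m Q.
    by rewrite trmx_mul tr_diag_mx -DM !mulmxA.
  rewrite ME /D /Q !mulmx_diag; congr diag_mx; apply/rowP => j; rewrite !mxE.
  by rewrite -[RHS]mulr1 -(qM j); ring.
Qed.

Lemma det_pencil2 (x y : V) t : \det (y - t *: x : 'M_3) =
  \det y - t * (polar_det y y x / 2) + t ^+ 2 * (polar_det x x y / 2)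
  - t ^+ 3 * \det x.
Proof.
rewrite !polar_detE (sym6_eta x) (sym6_eta y) !det_mx33 !mxE /= /polar6.
by field.
Qed.

Lemma pencil_roots (c : 'I_10 -> K) (d0 := c (@Ordinal 10 0 isT)) :
  (pencil_den K).@[c] != 0 -> exists r1 r2 r3,
  [/\ d0 != 0,
      [/\ c (@Ordinal 10 3 isT) = d0 * 2 * (r1 + r2 + r3),
          c (@Ordinal 10 5 isT) = d0 * 2 * (r1 * r2 + r1 * r3 + r2 * r3)
        & c (@Ordinal 10 1 isT) = d0 * (r1 * r2 * r3)]
    & [/\ r1 - r2 != 0, r1 - r3 != 0 & r2 - r3 != 0]].
Proof.
rewrite pencil_denE -/d0.
move: (c (@Ordinal 10 1 isT)) (c (@Ordinal 10 3 isT)) (c (@Ordinal 10 5 isT)).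
move=> d1 h3 h5; rewrite mulf_eq0 negb_or => /andP[d0n disc].
have [r1 [r2 [r3 [E1 E2 E3]]]] :=
  cubic_split (- (h3 / 2 / d0)) (h5 / 2 / d0) (- (d1 / d0)).
have H3 : h3 = d0 * 2 * (r1 + r2 + r3) by rewrite -[_ + r3]opprK -E1; field.
have H5 : h5 = d0 * 2 * (r1 * r2 + r1 * r3 + r2 * r3) by rewrite -E2; field.
have H1 : d1 = d0 * (r1 * r2 * r3) by rewrite -[_ * r3]opprK -E3; field.
exists r1, r2, r3; split=> //.
have : (r1 - r2) * (r1 - r3) * (r2 - r3) != 0.
  apply: contraNneq disc => z0; apply/eqP; rewrite H3 H5 H1.
  transitivity (16 * d0 ^+ 4 * ((r1 - r2) * (r1 - r3) * (r2 - r3)) ^+ 2).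
    by ring.
  by rewrite z0 expr0n mulr0.
by rewrite !mulf_eq0 !negb_or => /andP[/andP[r12 r13] r23].
Qed.

Lemma slice_normal_form v : (pencil_den K).@[fvec v] != 0 ->
  exists s (g : 'M[K]_3), \det g = 1 /\ slice_of s = diag_congr g v.
Proof.
move=> /pencil_roots[r1 [r2 [r3]]]; rewrite /fvec !(tnth_nth 0) /=.
case: v => [[x y] z]; rewrite /on_triple /=; set d0 := \det x; set d1 := \det y.
set h3 := polar_det x x y; set h5 := polar_det y y x.
move=> [d0n [H3 H5 H1] [r12 r13 r23]].
pose e (i : 'I_3) := nth 0 [:: r1; r2; r3] i.
have inj_e : injective e.
  have n12 : r1 != r2 by rewrite -subr_eq0.
  have n13 : r1 != r3 by rewrite -subr_eq0.
  have n23 : r2 != r3 by rewrite -subr_eq0.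
  move=> i j; move: i j; do 2![apply: ord3P]; rewrite /e //= => /eqP;
  by rewrite ?(negbTE n12) ?(negbTE n13) ?(negbTE n23) // eq_sym
    ?(negbTE n12) ?(negbTE n13) ?(negbTE n23).
have sing i : \det (y - e i *: x : 'M_3) = 0.
  rewrite det_pencil2 -/h3 -/h5 -/d0 -/d1 H3 H5 H1.
  by move: i; apply: ord3P; rewrite /e /=; field.
have /is_sym_mxP xT := sym_valP x; have /is_sym_mxP yT := sym_valP y.
have [g [dg gx gy]] := congr_diag xT yT d0n inj_e sing.
(* rescaling g to determinant 1 multiplies the normal form by nu^2 *)
pose nu := 3.-root (\det g)^-1.
have nu3 : nu ^+ 3 * \det g = 1 by rewrite rootCK // mulVf.
have nu0 : nu != 0.
  by apply/eqP => n0; move/eqP: nu3; rewrite n0 expr0n mul0r eq_sym oner_eq0.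
have l0 : nu ^+ 2 != 0 by rewrite expf_neq0.
pose w := sym_congr g z.
pose s := SliceParam (w i0 i0) (w i1 i1) (w i2 i2)
  (w i1 i2) (w i0 i2) (w i0 i1) l0 r12 r13 r23.
exists s, (nu *: g); split; first by rewrite detZ.
have scal (u : V) : sym_congr (nu *: g) u = nu ^+ 2 *: sym_congr g u.
  by apply/val_inj; rewrite /= !linearZ /= -!scalemxAl scalerA expr2.
rewrite /diag_congr /= !scal /slice_of /slice_pt /= -/w; do !congr (_, _).
- apply/val_inj; rewrite [RHS]/= gx.
  by apply/matrixP; do 2![apply: ord3P]; rewrite !mxE /= ?mulr1 ?mulr0.
- apply/val_inj; rewrite [RHS]/= gy.
  by apply/matrixP; do 2![apply: ord3P];
    rewrite !mxE /= ?mulr1n ?mulr0n ?mulr0 /e.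
- rewrite [in RHS](sym6_eta w).
  by apply/val_inj/matrixP; do 2![apply: ord3P]; rewrite !mxE.
Qed.

Theorem localized_generation P : @invariants3 K P ->
  exists m (a : 'I_3 -> {mpoly K[10]}), forall v,
    (pencil_den K).@[fvec v] ^+ m * P v =
    \sum_(i < 3) (a i).@[fvec v] * f11 v ^+ i.
Proof.
move=> Pinv; have [_ Pact] := Pinv.
have [c [lc cE]] := slice_invariant Pinv.
have [m [a aE]] := local_B_common_den lc.
(* four factors E turn f11 / l^6 into f11, and the fifth one makes both sides
   vanish where the slice is not reached *)
exists (m + 4).+1, (fun i => pencil_den K * pencil_disc K ^+ 4 *
   (a i * nth 0 [:: X 0 ^+ 4; X 0 ^+ 2; 1] i)) => v.
have [v0|vn0] := eqVneq ((pencil_den K).@[fvec v]) 0.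
  rewrite v0 exprS !mul0r big1 // => i _.
  by rewrite -mulrA mevalM v0 !mul0r.
have [s [g [dg sE]]] := slice_normal_form vn0.
have -> : P v = P (slice_of s) by rewrite sE Pact.
rewrite -(f11_congr v dg) -(fvec_congr v dg) -sE -/(slice_den s) exprS.
have := cE s; rewrite /= => ->; rewrite big_ord3 /= expr0 expr1.
set D := (pencil_disc K).@[fvec (slice_of s)].
have x0 : (X 0 : {mpoly K[10]}).@[fvec (slice_of s)] = sl s ^+ 3.
  by rewrite mevalXU fvec_slice.
have term i q :
    (pencil_den K * pencil_disc K ^+ 4 * (a i * q)).@[fvec (slice_of s)] =
    slice_den s * D ^+ 4 * (slice_den s ^+ m * c i s * q.@[fvec (slice_of s)]).
  rewrite (mevalM _ (pencil_den K * _)) (mevalM _ (pencil_den K)).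
  by rewrite (mevalM _ (a i)) rmorphXn aE.
have dE : slice_den s ^+ 4 = (sl s ^+ 3) ^+ 4 * D ^+ 4.
  by rewrite /slice_den /pencil_den mevalM x0 exprMn.
rewrite !term !rmorphXn /= x0 meval1 sphi_f11 exprD dE.
by ring.
Qed.

End NormalForm.

(** * Independence of 1, f11, f11^2 *)

Section Independence.
Variable K : numClosedFieldType.

(** The values of f1, ..., f10 at a point of the slice, in terms of ten
    independent parameters: B0, B1 and d replace p1, p2 and p3. *)
Definition param_fvec (l y1 y2 y3 a1 a2 a3 B0 B1 d : K) : 'I_10 -> K :=
  fun i => nth 0
  [:: l ^+ 3; l ^+ 3 * (y1 * y2 * y3); l ^+ 3 * d;
      l ^+ 3 * 2 * (y1 + y2 + y3);
      l ^+ 3 * 2 * (a1 + a2 + a3);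
      l ^+ 3 * 2 * (y1 * y2 + y1 * y3 + y2 * y3);
      l ^+ 3 * 2 * (a1 * (y2 * y3) + a2 * (y1 * y3) + a3 * (y1 * y2));
      l ^+ 3 * 2 * B0; l ^+ 3 * 2 * B1;
      l ^+ 3 * (a1 * (y2 + y3) + a2 * (y1 + y3) + a3 * (y1 + y2))] i.

(** A root phi determines the numbers w_i that p_i^2 has to be and the number u
    that p1 p2 p3 has to be, and the cubic equation says w1 w2 w3 = u^2.  So
    the square roots of the w_i can be chosen with product u. *)
Lemma param_fvec_realised l y1 y2 y3 a1 a2 a3 B0 B1 d phi :
  y1 - y2 != 0 -> y1 - y3 != 0 -> y2 - y3 != 0 ->
  phi ^+ 3 + cub2 y1 y2 y3 a1 a2 a3 B0 B1 * phi ^+ 2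
    + cub1 y1 y2 y3 a1 a2 a3 B0 B1 d * phi
    + cub0 y1 y2 y3 a1 a2 a3 B0 B1 d = 0 ->
  exists v, fvec v = param_fvec l y1 y2 y3 a1 a2 a3 B0 B1 d /\
            f11 v = l ^+ 6 * phi.
Proof.
move=> y12 y13 y23 root_phi.
have y21 := subr_neq0C y12; have y31 := subr_neq0C y13.
have y32 := subr_neq0C y23.
pose w1 := (phi + kappa y1 y2 y3 a2 a3 B0 B1) / ((y1 - y2) * (y1 - y3)).
pose w2 := (phi + kappa y2 y1 y3 a1 a3 B0 B1) / ((y2 - y1) * (y2 - y3)).
pose w3 := (phi + kappa y3 y1 y2 a1 a2 B0 B1) / ((y3 - y1) * (y3 - y2)).
pose u := (d - a1 * a2 * a3 + a1 * w1 + a2 * w2 + a3 * w3) / 2.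
have uE : w1 * w2 * w3 = u ^+ 2.
  have k1 : phi + kappa y1 y2 y3 a2 a3 B0 B1 = w1 * ((y1 - y2) * (y1 - y3)).
    by rewrite /w1; field; rewrite y12 y13.
  have k2 : phi + kappa y2 y1 y3 a1 a3 B0 B1 = w2 * ((y2 - y1) * (y2 - y3)).
    by rewrite /w2; field; rewrite y21 y23.
  have k3 : phi + kappa y3 y1 y2 a1 a2 B0 B1 = w3 * ((y3 - y1) * (y3 - y2)).
    by rewrite /w3; field; rewrite y31 y32.
  have ku : lin0 y1 y2 y3 a1 a2 a3 B0 B1 d + lin1 y1 y2 y3 a1 a2 a3 * phi =
      vandermonde3 y1 y2 y3 * u.
    rewrite /lin0 /lin1 /u.
    have -> : kappa y1 y2 y3 a2 a3 B0 B1
        = w1 * ((y1 - y2) * (y1 - y3)) - phi by rewrite -k1; ring.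
    have -> : kappa y2 y1 y3 a1 a3 B0 B1
        = w2 * ((y2 - y1) * (y2 - y3)) - phi by rewrite -k2; ring.
    have -> : kappa y3 y1 y2 a1 a2 B0 B1
        = w3 * ((y3 - y1) * (y3 - y2)) - phi by rewrite -k3; ring.
    by clearbody w1 w2 w3; rewrite /vandermonde3; field.
  have vn0 : vandermonde3 y1 y2 y3 ^+ 2 != 0.
    by rewrite expf_neq0 // /vandermonde3 !mulf_neq0.
  apply: (mulfI vn0); rewrite -exprMn -ku.
  transitivity (- ((phi + kappa y1 y2 y3 a2 a3 B0 B1)
     * (phi + kappa y2 y1 y3 a1 a3 B0 B1)
     * (phi + kappa y3 y1 y2 a1 a2 B0 B1))).
    by rewrite k1 k2 k3 /vandermonde3; ring.
  apply/eqP; rewrite -subr_eq0 -oppr_eq0 -root_phi /cub2 /cub1 /cub0.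
  by apply/eqP; ring.
pose p1 := sqrtC w1; pose p2 := sqrtC w2.
have [p3 p3w pu] : exists2 p3, p3 ^+ 2 = w3 & p1 * p2 * p3 = u.
  have : (p1 * p2 * sqrtC w3) ^+ 2 == u ^+ 2.
    by rewrite -uE (exprMn _ (p1 * p2)) (exprMn _ p1) !sqrtCK.
  rewrite eqf_sqr => /orP[] /eqP E; first by exists (sqrtC w3); rewrite ?sqrtCK.
  by exists (- sqrtC w3); rewrite ?sqrrN ?sqrtCK // mulrN E opprK.
exists (slice_pt l y1 y2 y3 a1 a2 a3 p1 p2 p3).
rewrite fvec_slice f11_slice p3w pu /p1 /p2 !sqrtCK; split.
  rewrite /param_fvec; apply/funext => i; congr (nth 0 _ i).
  congr [:: _; _; _; _; _; _; _; _; _; _];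
    congr (_ * _); rewrite ?/u /w1 /w2 /w3 /kappa.
  - by field; rewrite y12 y13 y21 y23 y31 y32.
  - by field; rewrite y12 y13 y21 y23 y31 y32.
  - by field; rewrite y12 y13 y21 y23 y31 y32.
congr (_ * _); rewrite /w1 /w2 /w3 /kappa; field.
by rewrite y12 y13 y21 y23 y31 y32.
Qed.

(** The discriminant of T^3 + A T^2 + B T + C. *)
Definition cubic_disc (A B C : K) :=
  A ^+ 2 * B ^+ 2 - 4 * B ^+ 3 - 4 * A ^+ 3 * C + 18 * A * B * C - 27 * C ^+ 2.

Lemma quadratic_zero (q : 'I_3 -> K) (x1 x2 x3 : K) :
  x1 - x2 != 0 -> x1 - x3 != 0 -> x2 - x3 != 0 ->
  (forall x, x \in [:: x1; x2; x3] -> \sum_(i < 3) q i * x ^+ i = 0) ->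
  forall i, q i = 0.
Proof.
move=> n12 n13 n23 qx; have := qx x1; have := qx x2; have := qx x3.
rewrite !inE !eqxx ?orbT !big_ord3 /= !expr0 !expr1 !mulr1.
move=> /(_ isT) E3 /(_ isT) E2 /(_ isT) E1.
have Q2 : q i2 = 0.
  have : (x1 - x2) * (x1 - x3) * (x2 - x3) * q i2 = 0.
    transitivity ((x2 - x3) * (q i0 + q i1 * x1 + q i2 * x1 ^+ 2)
     - (x1 - x3) * (q i0 + q i1 * x2 + q i2 * x2 ^+ 2)
     + (x1 - x2) * (q i0 + q i1 * x3 + q i2 * x3 ^+ 2)); first by ring.
    by rewrite E1 E2 E3; ring.
  move/eqP; rewrite !mulf_eq0 (negbTE n12) (negbTE n13) (negbTE n23).
  by move=> /eqP.
have Q1 : q i1 = 0.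
  have : (x1 - x2) * q i1 = 0.
    transitivity ((q i0 + q i1 * x1 + q i2 * x1 ^+ 2)
      - (q i0 + q i1 * x2 + q i2 * x2 ^+ 2)
      - q i2 * (x1 ^+ 2 - x2 ^+ 2)); first by ring.
    by rewrite E1 E2 Q2; ring.
  by move/eqP; rewrite mulf_eq0 (negbTE n12) => /eqP.
have Q0 : q i0 = 0 by rewrite -E1 Q1 Q2; ring.
exact: ord3P.
Qed.

Section Annihilator.
Variable p : 'I_3 -> {mpoly K[10]}.
Hypothesis p0 : forall v, \sum_(i < 3) (p i).@[fvec v] * f11 v ^+ i = 0.

Lemma annihilator_param_generic l y1 y2 y3 a1 a2 a3 B0 B1 d :
  l * vandermonde3 y1 y2 y3 * cubic_disc (cub2 y1 y2 y3 a1 a2 a3 B0 B1)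
    (cub1 y1 y2 y3 a1 a2 a3 B0 B1 d) (cub0 y1 y2 y3 a1 a2 a3 B0 B1 d) != 0 ->
  forall i, (p i).@[param_fvec l y1 y2 y3 a1 a2 a3 B0 B1 d] = 0.
Proof.
have := @param_fvec_realised l y1 y2 y3 a1 a2 a3 B0 B1 d.
set A := cub2 _ _ _ _ _ _ _ _; set B := cub1 _ _ _ _ _ _ _ _ _.
set C := cub0 _ _ _ _ _ _ _ _ _.
have [r1 [r2 [r3 [-> -> ->]]]] := cubic_split A B C.
move=> real; rewrite (_ : cubic_disc _ _ _ =
    ((r1 - r2) * (r1 - r3) * (r2 - r3)) ^+ 2); last first.
  by rewrite /cubic_disc; ring.
rewrite expr2 !mulf_eq0 !negb_or /vandermonde3.
move=> /andP[/andP[l0 /andP[/andP[y12 y13] y23]]].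
move=> /andP[/andP[/andP[r12 r13] r23] _].
have l6 : l ^+ 6 != 0 by rewrite expf_neq0.
apply: (@quadratic_zero (fun i => (p i).@[_])
  (l ^+ 6 * r1) (l ^+ 6 * r2) (l ^+ 6 * r3)).
- by rewrite -mulrBr mulf_neq0.
- by rewrite -mulrBr mulf_neq0.
- by rewrite -mulrBr mulf_neq0.
move=> x; rewrite !inE => xE.
have [r -> [v [<- <-]]] : exists2 r, x = l ^+ 6 * r & exists v,
    fvec v = param_fvec l y1 y2 y3 a1 a2 a3 B0 B1 d /\ f11 v = l ^+ 6 * r.
  case/or3P: xE => /eqP ->.
  - by exists r1 => //; apply: real => //; ring.
  - by exists r2 => //; apply: real => //; ring.
  - by exists r3 => //; apply: real => //; ring.
exact: p0.
Qed.

Lemma annihilator_param l y1 y2 y3 a1 a2 a3 B0 B1 d i :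
  (p i).@[param_fvec l y1 y2 y3 a1 a2 a3 B0 B1 d] = 0.
Proof.
pose x k (w : 'rV[K]_10) := w 0 (@inord 9 k).
pose F w := (p i).@[param_fvec (x 0 w) (x 1 w) (x 2 w) (x 3 w) (x 4 w) (x 5 w)
  (x 6 w) (x 7 w) (x 8 w) (x 9 w)].
pose N w := x 0 w * vandermonde3 (x 1 w) (x 2 w) (x 3 w) * cubic_disc
  (cub2 (x 1 w) (x 2 w) (x 3 w) (x 4 w) (x 5 w) (x 6 w) (x 7 w) (x 8 w))
  (cub1 (x 1 w) (x 2 w) (x 3 w) (x 4 w) (x 5 w) (x 6 w) (x 7 w) (x 8 w) (x 9 w))
  (cub0 (x 1 w) (x 2 w) (x 3 w) (x 4 w) (x 5 w) (x 6 w) (x 7 w) (x 8 w) (x 9 w)).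
have algP := @polyfun_alg K 'rV[K]_10.
have px k : polynomial_function (x k).
  by apply: polyfun_linear => c u v; rewrite /x !mxE.
have pN : polynomial_function N.
  rewrite /N /cubic_disc /cub2 /cub1 /cub0 /lin1 /lin0 /kappa /vandermonde3.
  by do ![exact: px | exact: (algC algP) | apply: (algX algP)
    | apply: (algM algP) | apply: (algD algP) | apply: (algN algP)].
have pF : polynomial_function F.
  rewrite /F /param_fvec; apply: (alg_meval algP).
  by case=> -[|[|[|[|[|[|[|[|[|[|//]]]]]]]]]] ? /=;
    do ![exact: px | exact: (algC algP) | apply: (algX algP)
    | apply: (algM algP) | apply: (algD algP) | apply: (algN algP)].
pose row (s : seq K) : 'rV[K]_10 := \row_k nth 0 s k.
have rowE s k : (k < 10)%N -> x k (row s) = nth 0 s k.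
  by move=> k10; rewrite /x mxE inordK.
have NF w : N w * F w = 0.
  have [->|/annihilator_param_generic Nw] := eqVneq (N w) 0.
    by rewrite mul0r.
  by rewrite /F Nw mulr0.
(* for these parameters the cubic is T^3 - T *)
have N0 : N (row [:: 1; 0; 1; -1; 0; 0; 0; 0; 1; 0]) != 0.
  rewrite /N !rowE //= (_ : _ * _ = - 8); first by rewrite oppr_eq0 pnatr_eq0.
  rewrite /cubic_disc /cub2 /cub1 /cub0 /lin1 /lin0 /kappa /vandermonde3.
  by field.
have := polyfun_dense pF pN N0 NF (row [:: l; y1; y2; y3; a1; a2; a3; B0; B1; d]).
by rewrite /F !rowE.
Qed.

(** Every point with E nonzero is parametrized: the y_i are the roots of the
    binary cubic and the a_i solve a Vandermonde system. *)
Theorem annihilator_vanishes c i : (pencil_den K).@[c] != 0 -> (p i).@[c] = 0.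
Proof.
move=> /pencil_roots[r1 [r2 [r3 [c0 [c3 c5 c1] [r12 r13 r23]]]]].
pose l := 3.-root (c (@Ordinal 10 0 isT)).
have l3 : l ^+ 3 = c (@Ordinal 10 0 isT) by rewrite rootCK.
have l0 : l ^+ 3 != 0 by rewrite l3.
have ln0 : l != 0 by move: l0; rewrite expf_eq0.
pose t0 := c (@Ordinal 10 4 isT) / (l ^+ 3 * 2).
pose t1 := c (@Ordinal 10 6 isT) / (l ^+ 3 * 2).
pose t2 := c (@Ordinal 10 9 isT) / l ^+ 3.
have r21 := subr_neq0C r12; have r31 := subr_neq0C r13.
have r32 := subr_neq0C r23.
pose a1 := (r1 ^+ 2 * t0 - r1 * t2 + t1) / ((r1 - r2) * (r1 - r3)).
pose a2 := (r2 ^+ 2 * t0 - r2 * t2 + t1) / ((r2 - r1) * (r2 - r3)).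
pose a3 := (r3 ^+ 2 * t0 - r3 * t2 + t1) / ((r3 - r1) * (r3 - r2)).
rewrite -[RHS](annihilator_param l r1 r2 r3 a1 a2 a3
  (c (@Ordinal 10 7 isT) / (l ^+ 3 * 2)) (c (@Ordinal 10 8 isT) / (l ^+ 3 * 2))
  (c (@Ordinal 10 2 isT) / l ^+ 3) i).
have e4 : c (@Ordinal 10 4 isT) = l ^+ 3 * 2 * (a1 + a2 + a3).
  transitivity (l ^+ 3 * 2 * t0); first by rewrite /t0; field.
  congr (_ * _); rewrite /a1 /a2 /a3; field.
  by rewrite r12 r13 r21 r23 r31 r32.
have e6 : c (@Ordinal 10 6 isT) =
    l ^+ 3 * 2 * (a1 * (r2 * r3) + a2 * (r1 * r3) + a3 * (r1 * r2)).
  transitivity (l ^+ 3 * 2 * t1); first by rewrite /t1; field.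
  congr (_ * _); rewrite /a1 /a2 /a3; field.
  by rewrite r12 r13 r21 r23 r31 r32.
have e9 : c (@Ordinal 10 9 isT) =
    l ^+ 3 * (a1 * (r2 + r3) + a2 * (r1 + r3) + a3 * (r1 + r2)).
  transitivity (l ^+ 3 * t2); first by rewrite /t2; field.
  congr (_ * _); rewrite /a1 /a2 /a3; field.
  by rewrite r12 r13 r21 r23 r31 r32.
clearbody a1 a2 a3.
apply: meval_eq; case=> -[|[|[|[|[|[|[|[|[|[|//]]]]]]]]]] lt_i;
by rewrite /param_fvec /= (bool_irrelevance lt_i isT) ?l3 //
  ?c3 ?c5 ?c1 ?e4 ?e6 ?e9 -?l3 //; field.
Qed.

End Annihilator.
End Independence.

(** * A change of variables *)

Section Shear.
Variable K : numClosedFieldType.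
Local Notation V := (sym_matrix K 3).
Local Notation X k := ('X_(@Ordinal 10 k isT)).
Implicit Types (v : V * V * V).

Definition shear v : V * V * V := (v.1.1 + v.1.2 + v.2, v.1.2 - v.2, v.2).

Definition unshear v : V * V * V :=
  (v.1.1 - v.1.2 - (v.2 + v.2), v.1.2 + v.2, v.2).

Lemma shearK v : unshear (shear v) = v.
Proof.
by case: v => [[x y] z]; congr (_, _, _); apply/val_inj/matrixP => i j;
  rewrite !mxE /=; ring.
Qed.

(** The effect of the shear on f1, ..., f10, by trilinearity of f. *)
Definition shear_fvec : 10.-tuple {mpoly K[10]} :=
  let q (a : K) := a%:MP in
  [tuple q (1/2) * (q 2 * (X 0 + X 1 + X 2 + X 9)
                    + X 3 + X 4 + X 5 + X 6 + X 7 + X 8);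
         q (1/2) * (q 2 * (X 1 - X 2) - X 6 + X 8);
         X 2;
         X 3 - X 4 + q 2 * X 5 + X 6 - q 2 * X 7 - X 8 + q 6 * X 1 - q 6 * X 2;
         X 4 + X 6 + q 6 * X 2 + q 2 * X 9 + q 2 * X 7 + q 2 * X 8;
         X 5 + X 7 - q 2 * X 9 + q 6 * X 1 + q 6 * X 2 - X 6 - X 8;
         X 6 - q 2 * X 8 + q 6 * X 2;
         X 7 + X 8 + q 6 * X 2;
         X 8 - q 6 * X 2;
         X 9 + X 6 - X 7 - q 6 * X 2].

(** Modulo B, f11 is multiplied by the square of the determinant of a change of
    variables, here 1; this is the element of B by which f11 itself changes. *)
Definition shear_f11 : {mpoly K[10]} :=
  let q (a : K) := a%:MP in
  q (1/2) * X 1 * X 7 + X 1 * X 8 + q 6 * X 2 ^+ 2 - q (1/2) * X 2 * X 3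
  + X 2 * X 4 - q (1/2) * X 2 * X 5 + X 2 * X 6 + q 2 * X 2 * X 7 + X 2 * X 9
  - q (1/4) * X 4 * X 8 + q (1/4) * X 5 * X 8 + q (1/4) * X 6 * X 7
  - q (1/2) * X 7 * X 8 - q (1/2) * X 8 ^+ 2 - q (1/2) * X 8 * X 9.

Lemma f11_shear v : f11 (shear v) = f11 v + shear_f11.@[fvec v].
Proof.
case: v => [[x y] z].
have [a1 [a2 [a3 [p1 [p2 [p3 [b1 [b2 [b3 [q1 [q2 [q3
  [c1 [c2 [c3 [r1 [r2 [r3 ->]]]]]]]]]]]]]]]]]] := triple_sym6 x y z.
rewrite /shear /= sym6N !sym6D.
have f11E u1 u2 u3 : f11 (u1, u2, u3) =
    polar_det (sym_adj u1) (sym_adj u2) (sym_adj u3) by [].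
rewrite !f11E !adj_sym6 /shear_f11 /= !mevalS /fvec !(tnth_nth 0) /=.
rewrite /on_triple /= !polar_det_sym6 !det_sym6 /polar6 /det6.
by field.
Qed.

Lemma fvec_shear v i : fvec (shear v) i = (tnth shear_fvec i).@[fvec v].
Proof.
case: v => [[x y] z].
have [a1 [a2 [a3 [p1 [p2 [p3 [b1 [b2 [b3 [q1 [q2 [q3
  [c1 [c2 [c3 [r1 [r2 [r3 ->]]]]]]]]]]]]]]]]]] := triple_sym6 x y z.
rewrite /shear /= sym6N !sym6D.
case: i => -[|[|[|[|[|[|[|[|[|[|//]]]]]]]]]] ?;
  rewrite [in RHS](tnth_nth 0) /= !mevalS /fvec !(tnth_nth 0) /=;
  rewrite /on_triple /= ?polar_det_sym6 ?det_sym6 /polar6 /det6;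
  by field.
Qed.

Lemma sym_congrD (g : 'M[K]_3) (x y : V) :
  sym_congr g (x + y) = sym_congr g x + sym_congr g y.
Proof. by apply/val_inj; rewrite /= mulmxDr mulmxDl. Qed.

Lemma sym_congrN (g : 'M[K]_3) (x : V) : sym_congr g (- x) = - sym_congr g x.
Proof. by apply/val_inj; rewrite /= mulmxN mulNmx. Qed.

Lemma invariants_unshear P : invariants3 P -> @invariants3 K (P \o unshear).
Proof.
have lin : linear unshear.
  by move=> a u v; congr (_, _, _); apply/val_inj/matrixP => i j;
    rewrite !mxE /=; ring.
case=> Ppf Pinv; split; first exact: polyfun_comp_linear.
move=> g dg v /=; rewrite -[RHS](Pinv g dg); congr P.
by rewrite /diag_congr /unshear /= !(sym_congrD, sym_congrN).
Qed.

End Shear.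

(** * Division with respect to f10 *)

Lemma rmorph_mmap (n : nat) (R : nzRingType) (S T : comNzRingType)
    (f : R -> S) (g : {rmorphism S -> T}) (h : 'I_n -> S) (p : {mpoly R[n]}) :
  g (mmap f h p) = mmap (g \o f) (g \o h) p.
Proof.
rewrite /mmap rmorph_sum; apply: eq_bigr => m _; rewrite rmorphM; congr (_ * _).
by rewrite /mmap1 rmorph_prod; apply: eq_bigr => i _; rewrite rmorphXn.
Qed.

Lemma monic_dvd_values (K : numFieldType) (d a b q r : {poly K}) (e : K) :
  d \is monic -> e != 0 -> (forall t, d.[t] * a.[t] = e * b.[t]) ->
  b = q * d + r -> (size r < size d)%N -> forall t, b.[t] = d.[t] * q.[t].
Proof.
move=> mon_d Ec vals split_b szr.
have key : d * a = e *: b.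
  apply/eqP; rewrite -subr_eq0; apply/eqP/poly_eq0_horner => t.
  by rewrite hornerD hornerN hornerM hornerZ vals subrr.
suff r0 : r = 0 by move=> t; rewrite split_b r0 addr0 hornerM mulrC.
have key2 : d * (a - e *: q) = e *: r.
  rewrite mulrBr key split_b scalerDr -scalerAr [d * q]mulrC.
  by rewrite addrAC subrr add0r.
apply/eqP; apply: contraLR szr => nz; rewrite -leqNgt.
rewrite -(size_scale r Ec) -key2.
have nz2 : a - e *: q != 0.
  apply/eqP => z; move: key2; rewrite z mulr0 => /esym/eqP.
  by rewrite scaler_eq0 (negbTE Ec) (negbTE nz).
rewrite size_monicM // -subn1 -addnBA ?leq_addr //.
by rewrite size_poly_gt0.
Qed.

Section Division.
Variable K : numClosedFieldType.
Local Notation X k := ('X_(@Ordinal 10 k isT)).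

Definition lastX : 'I_10 := @Ordinal 10 9 isT.

(** A polynomial read as a univariate one in the last variable.  The
    coefficients are kept in the same ring, so that the last variable can be
    substituted back. *)
Definition isolate : {mpoly K[10]} -> {poly {mpoly K[10]}} :=
  mmap (polyC \o @mpolyC 10 K) (fun i => if i == lastX then 'X else ('X_i)%:P).
HB.instance Definition _ := GRing.RMorphism.on isolate.

Definition subst_last (c : 'I_10 -> K) (t : K) i :=
  if i == lastX then t else c i.

Lemma isolate_eval a c t :
  (map_poly (meval c) (isolate a)).[t] = a.@[subst_last c t].
Proof.
pose ev : {rmorphism {poly {mpoly K[10]}} -> K} :=
  horner_eval t \o map_poly (meval c).
rewrite -[LHS]/(ev (isolate a)) rmorph_mmap /meval /mmap.
apply: eq_bigr => m _; congr (_ * _).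
  by rewrite /= map_polyC /horner_eval hornerC /= mevalC.
rewrite /mmap1; apply: eq_bigr => i _; congr (_ ^+ _).
rewrite /= /horner_eval /subst_last; case: eqP => _.
  by rewrite map_polyX hornerX.
by rewrite map_polyC hornerC /= mevalXU.
Qed.

Lemma isolateX k : k != lastX -> isolate 'X_k = ('X_k)%:P.
Proof. by move=> /negbTE kl; rewrite /isolate mmapX mmap1U kl. Qed.

Lemma isolateX_last : isolate 'X_lastX = 'X.
Proof. by rewrite /isolate mmapX mmap1U eqxx. Qed.

Lemma isolateC (b : K) : isolate b%:MP = (b%:MP)%:P.
Proof. by rewrite /isolate mmapC. Qed.

Lemma isolateD (a b : {mpoly K[10]}) : isolate (a + b) = isolate a + isolate b.
Proof. exact: rmorphD. Qed.

Lemma isolateN (a : {mpoly K[10]}) : isolate (- a) = - isolate a.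
Proof. exact: rmorphN. Qed.

Lemma isolateM (a b : {mpoly K[10]}) : isolate (a * b) = isolate a * isolate b.
Proof. exact: rmorphM. Qed.

Lemma isolateXn (a : {mpoly K[10]}) n : isolate (a ^+ n) = isolate a ^+ n.
Proof. exact: rmorphXn. Qed.

(** The Euclidean division of b by D specializes to every c.  On the line
    through c in the last direction E is a nonzero constant and D divides E b,
    so that the remainder vanishes there. *)
Lemma monic_coprime (D E a b : {mpoly K[10]}) :
  isolate D \is monic -> (forall c t, E.@[subst_last c t] = E.@[c]) ->
  (forall c, E.@[c] != 0 -> D.@[c] * a.@[c] = E.@[c] * b.@[c]) ->
  exists q : {mpoly K[10]}, forall c, E.@[c] != 0 -> b.@[c] = D.@[c] * q.@[c].
Proof.
move=> monD freeE DE.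
pose Q := Pdiv.Ring.rdivp (isolate b) (isolate D).
pose r := Pdiv.Ring.rmodp (isolate b) (isolate D).
exists Q.['X_lastX] => c Ec.
have bE : isolate b = Q * isolate D + r := Pdiv.RingMonic.rdivp_eq monD _.
pose e := E.@[c].
have idc : subst_last c (c lastX) = c.
  by apply/funext => i; rewrite /subst_last; case: eqP => [->|].
have [ev evE] : exists ev : {rmorphism {poly {mpoly K[10]}} -> {poly K}},
    ev =1 map_poly (meval c).
  by exists (map_poly (meval c)).
have mon_d : ev (isolate D) \is monic by rewrite evE; apply: monic_map.
have dE t : (ev (isolate D)).[t] = D.@[subst_last c t].
  by rewrite evE isolate_eval.
have aE t : (ev (isolate a)).[t] = a.@[subst_last c t].
  by rewrite evE isolate_eval.
have bbE t : (ev (isolate b)).[t] = b.@[subst_last c t].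
  by rewrite evE isolate_eval.
have split_b : ev (isolate b) = ev Q * ev (isolate D) + ev r.
  by rewrite -rmorphM -rmorphD; congr (ev _).
have szr : (size (ev r) < size (ev (isolate D)))%N.
  rewrite (evE (isolate D)) (size_map_poly_id0 (p := isolate D)); last first.
    by rewrite (monicP monD) meval1 oner_neq0.
  rewrite evE; apply: leq_ltn_trans (size_poly _ _) _.
  by rewrite Pdiv.Ring.ltn_rmodpN0 // monic_neq0.
have qE : (ev Q).[c lastX] = (Q.['X_lastX]).@[c].
  by rewrite evE -horner_map /= mevalXU.
have vals t :
    (ev (isolate D)).[t] * (ev (isolate a)).[t] = e * (ev (isolate b)).[t].
  have Ect : E.@[subst_last c t] = e := freeE c t.
  have DEt := DE (subst_last c t); rewrite Ect in DEt.
  by have := DEt Ec; rewrite -(dE t) -(aE t) -(bbE t).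
have v1 := monic_dvd_values mon_d Ec vals split_b szr (c lastX).
have v2 := dE (c lastX); have v3 := bbE (c lastX); rewrite idc in v2 v3.
exact: etrans (esym v3) (etrans v1 (f_equal2 *%R v2 qE)).
Qed.

Definition last_free (a : {mpoly K[10]}) := isolate a = a%:P.

Lemma last_freeD a b : last_free a -> last_free b -> last_free (a + b).
Proof. by rewrite /last_free isolateD => -> ->; rewrite polyCD. Qed.

Lemma last_freeN a : last_free a -> last_free (- a).
Proof. by rewrite /last_free isolateN => ->; rewrite polyCN. Qed.

Lemma last_freeM a b : last_free a -> last_free b -> last_free (a * b).
Proof. by rewrite /last_free isolateM => -> ->; rewrite polyCM. Qed.

Lemma last_freeX a n : last_free a -> last_free (a ^+ n).
Proof. by rewrite /last_free isolateXn => ->; rewrite polyC_exp. Qed.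

Lemma last_freeC (a : K) : last_free a%:MP. Proof. exact: isolateC. Qed.

Lemma last_freeU k : k != lastX -> last_free 'X_k. Proof. exact: isolateX. Qed.

Lemma isolate_lastD a : last_free a -> isolate (X 9 + a) = 'X + a%:P.
Proof. by rewrite isolateD => ->; rewrite -isolateX_last. Qed.

End Division.

Ltac last_free := repeat first [exact: last_freeC | by apply: last_freeU
  | apply: last_freeX | apply: last_freeN | apply: last_freeM
  | apply: last_freeD ].

(** * The sheared denominator *)

Lemma sheared_shape_monic (R : idomainType) (a b c1 c2 c3 c4 : R)
    (A := 'X + a%:P) (B := 'X + b%:P) :
  A * (A * B ^+ 3 + (c1%:P * B ^+ 2 + c2%:P + c3%:P * A * B + c4%:P * A ^+ 2))
    \is monic.
Proof.
have mX (r : R) : 'X + r%:P \is monic.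
  by rewrite -(opprK r) polyCN monicXsubC.
have sX (r : R) : size ('X + r%:P) = 2%N.
  by rewrite -(opprK r) polyCN size_XsubC.
rewrite monicMl ?mX //.
have mAB : A * B ^+ 3 \is monic by rewrite monicMl ?mX // monic_exp ?mX.
have sAB : size (A * B ^+ 3) = 5%N.
  have mB3 : B ^+ 3 \is monic by rewrite monic_exp ?mX.
  rewrite size_monicM ?mX ?(monic_neq0 mB3) //.
  by rewrite (polySpred (monic_neq0 mB3)) size_exp /A /B !sX.
rewrite monicE lead_coefDl; first exact/eqP/monicP.
rewrite sAB ltnS.
have sC (r : R) (p : {poly R}) : (size p <= 3)%N -> (size (r%:P * p)%R <= 3)%N.
  by move=> sp; rewrite mul_polyC; apply: leq_trans (size_scale_leq _ _) sp.
have s2 (p q : {poly R}) :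
    size p = 2%N -> size q = 2%N -> (size (p * q)%R <= 3)%N.
  by move=> sp sq; apply: leq_trans (size_polyMleq _ _) _; rewrite sp sq.
have sD (p q : {poly R}) :
    (size p <= 3)%N -> (size q <= 3)%N -> (size (p + q)%R <= 3)%N.
  by move=> sp sq; apply: leq_trans (size_polyD _ _) _; rewrite geq_max sp sq.
apply: leq_trans (_ : 3 <= 4)%N => //.
apply: (sD); first apply: (sD); first apply: (sD).
- by apply: sC; apply: s2; apply: sX.
- exact: leq_trans (size_polyC_leq1 _) _.
- by rewrite -mulrA; apply: sC; apply: s2; apply: sX.
- by apply: sC; apply: s2; apply: sX.
Qed.

Section ShearedDenominator.
Variable K : numClosedFieldType.
Local Notation V := (sym_matrix K 3).
Local Notation X k := ('X_(@Ordinal 10 k isT)).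
Implicit Types (v : V * V * V).

Let q (a : K) : {mpoly K[10]} := a%:MP.

(** The shear turns X 0 into X 9 + shear_a, X 5 into - 2 (X 9 + shear_b), X 3
    into shear_g and X 1 into shear_h. *)
Definition shear_a : {mpoly K[10]} :=
  X 0 + X 1 + X 2 + q (1/2) * (X 3 + X 4 + X 5 + X 6 + X 7 + X 8).
Definition shear_b : {mpoly K[10]} :=
  q (1/2) * (X 6 + X 8 - X 5 - X 7) - q 3 * (X 1 + X 2).
Definition shear_g : {mpoly K[10]} :=
  X 3 - X 4 + q 2 * X 5 + X 6 - q 2 * X 7 - X 8 + q 6 * X 1 - q 6 * X 2.
Definition shear_h : {mpoly K[10]} := X 1 - X 2 + q (1/2) * (X 8 - X 6).

(** The composite of E with the shear, divided by its leading coefficient 64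
    as a polynomial in X 9. *)
Definition sheared_den : {mpoly K[10]} :=
  let A := X 9 + shear_a in let B := X 9 + shear_b in
  A * (A * B ^+ 3 + (q (1/16) * shear_g ^+ 2 * B ^+ 2
     + (- q (1/8) * shear_g ^+ 3 * shear_h)
     + (- q (9/4) * shear_g * shear_h) * A * B
     + (- q (27/4) * shear_h ^+ 2) * A ^+ 2)).

Lemma sheared_den_eval (c : 'I_10 -> K) :
  (pencil_den K).@[fun i => (tnth (shear_fvec K) i).@[c]] = 64 * sheared_den.@[c].
Proof.
have E0 : (tnth (shear_fvec K) (@Ordinal 10 0 isT)).@[c] = (X 9 + shear_a).@[c].
  by rewrite (tnth_nth 0) /= /shear_a /q !mevalS; field.
have E5 : (tnth (shear_fvec K) (@Ordinal 10 5 isT)).@[c] =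
    - 2 * (X 9 + shear_b).@[c].
  by rewrite (tnth_nth 0) /= /shear_b /q !mevalS; field.
have E3 : (tnth (shear_fvec K) (@Ordinal 10 3 isT)).@[c] = shear_g.@[c].
  by rewrite (tnth_nth 0).
have E1 : (tnth (shear_fvec K) (@Ordinal 10 1 isT)).@[c] = shear_h.@[c].
  by rewrite (tnth_nth 0) /= /shear_h /q !mevalS; field.
rewrite pencil_denE E0 E5 E3 E1 /sheared_den.
move: (X 9 + shear_a) (X 9 + shear_b) shear_g shear_h => A B G H.
rewrite /q !(mevalD, mevalN, mevalM, rmorphXn, mevalC) /=.
move: (A.@[c]) (B.@[c]) (G.@[c]) (H.@[c]) => {A B G H} A B G H.
by field.
Qed.

Lemma sheared_denE v :
  (pencil_den K).@[fvec (shear v)] = 64 * sheared_den.@[fvec v].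
Proof.
by rewrite -sheared_den_eval; apply: meval_eq => i; exact: fvec_shear.
Qed.

Lemma isolate_monic (a b g1 g2 g3 g4 A B : {mpoly K[10]}) :
  isolate A = 'X + a%:P -> isolate B = 'X + b%:P ->
  last_free g1 -> last_free g2 -> last_free g3 -> last_free g4 ->
  isolate (A * (A * B ^+ 3 + (g1 * B ^+ 2 + g2 + g3 * A * B + g4 * A ^+ 2)))
    \is monic.
Proof.
move=> iA iB h1 h2 h3 h4.
rewrite !(isolateM, isolateD, isolateXn) iA iB h1 h2 h3 h4.
exact: sheared_shape_monic.
Qed.

Lemma sheared_den_monic : isolate sheared_den \is monic.
Proof.
have fA : last_free shear_a by rewrite /shear_a; last_free.
have fB : last_free shear_b by rewrite /shear_b; last_free.
have fG : last_free shear_g by rewrite /shear_g; last_free.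
have fH : last_free shear_h by rewrite /shear_h; last_free.
by apply: isolate_monic (isolate_lastD fA) (isolate_lastD fB) _ _ _ _; last_free.
Qed.

Lemma pencil_den_last_free c t :
  (pencil_den K).@[subst_last c t] = (pencil_den K).@[c].
Proof. by rewrite !pencil_denE. Qed.

(** Three diagonal matrices at which E and the sheared E are both nonzero. *)
Definition base_pt := slice_pt (1 : K) 0 1 2 0 0 0 0 0 0.

Lemma base_den : (pencil_den K).@[fvec base_pt] != 0.
Proof.
rewrite /pencil_den mevalM pencil_disc_slice mevalXU fvec_slice /=.
by rewrite (_ : _ * _ = 64) ?pnatr_eq0 //; ring.
Qed.

Lemma base_sheared_den : sheared_den.@[fvec base_pt] != 0.
Proof.
pose c (i : 'I_10) : K := nth 0 [:: 1; 0; 0; 6; 0; 4; 0; 0; 0; 0] i.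
have -> : sheared_den.@[fvec base_pt] = sheared_den.@[c].
  apply: meval_eq => i; rewrite fvec_slice /c; congr (nth 0 _ i).
  by congr [:: _; _; _; _; _; _; _; _; _; _]; ring.
have eA : (X 9 + shear_a).@[c] = 6 by rewrite /shear_a /q !mevalS /c /=; field.
have eB : (X 9 + shear_b).@[c] = - 2.
  by rewrite /shear_b /q !mevalS /c /=; field.
have eG : shear_g.@[c] = 14 by rewrite /shear_g /q !mevalS /c /=; ring.
have eH : shear_h.@[c] = 0 by rewrite /shear_h /q !mevalS /c /=; ring.
rewrite /sheared_den.
move: (X 9 + shear_a) (X 9 + shear_b) shear_g shear_h eA eB eG eH.
move=> A B G H eA eB eG eH.
rewrite /q !(mevalD, mevalN, mevalM, rmorphXn, mevalC) /= eA eB eG eH.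
rewrite (_ : _ * _ = 6); first by rewrite pnatr_eq0.
by field.
Qed.

End ShearedDenominator.

(** * The module structure *)

Section Generation.
Variable K : numClosedFieldType.
Local Notation V := (sym_matrix K 3).
Implicit Types (v : V * V * V).

Theorem f11_combination_unique (a : 'I_3 -> {mpoly K[10]}) :
  (forall v, \sum_(i < 3) (a i).@[fvec v] * f11 v ^+ i = 0) ->
  forall i v, (a i).@[fvec v] = 0.
Proof.
move=> a0 i; apply: (polyfun_dense (polyfun_meval_fvec (a i))
  (polyfun_meval_fvec (pencil_den K)) (base_den K)) => v.
have [->|den0] := eqVneq ((pencil_den K).@[fvec v]) 0; first by rewrite mul0r.
by rewrite (annihilator_vanishes a0) ?mulr0.
Qed.

Lemma sheared_generation P : @invariants3 K P ->
  exists m (b : 'I_3 -> {mpoly K[10]}), forall v,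
    (sheared_den K).@[fvec v] ^+ m * P v =
    \sum_(i < 3) (b i).@[fvec v] * f11 v ^+ i.
Proof.
move=> /invariants_unshear/localized_generation[m [a aE]].
pose b i := a i \mPo shear_fvec K.
have bE i v : (b i).@[fvec v] = (a i).@[fvec (shear v)].
  by rewrite /b comp_mpoly_meval; apply: meval_eq => k; rewrite fvec_shear.
(* the expansion of a combination of 1, f11 + s, (f11 + s)^2 *)
pose s := shear_f11 K.
exists m, (fun i => (64^-1 ^+ m : K)%:MP * nth 0
  [:: b i0 + b i1 * s + b i2 * s ^+ 2; b i1 + (2 : K)%:MP * b i2 * s; b i2] i).
move=> v.
have E64 : (sheared_den K).@[fvec v] = 64^-1 * (pencil_den K).@[fvec (shear v)].
  by rewrite sheared_denE mulrA mulVf ?mul1r // pnatr_eq0.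
have := aE (shear v); rewrite /= shearK => aEv.
have evs (c : 'I_10 -> K) (x k : K) (g0 g1 g2 t : {mpoly K[10]}) :
    (k%:MP * (g0 + g1 * t + g2 * t ^+ 2)).@[c]
      + (k%:MP * (g1 + (2 : K)%:MP * g2 * t)).@[c] * x
      + (k%:MP * g2).@[c] * x ^+ 2 =
    k * (g0.@[c] + g1.@[c] * (x + t.@[c]) + g2.@[c] * (x + t.@[c]) ^+ 2).
  by rewrite !(mevalM, mevalC, mevalD, rmorphXn) /=; ring.
rewrite [RHS]big_ord3 expr0 expr1 mulr1 evs !bE -/s -f11_shear.
rewrite E64 exprMn -(mulrA _ _ (P v)) aEv.
by rewrite big_ord3 expr0 expr1 mulr1.
Qed.

Theorem f11_generation P : @invariants3 K P ->
  exists a : 'I_3 -> {mpoly K[10]}, forall v,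
    P v = \sum_(i < 3) (a i).@[fvec v] * f11 v ^+ i.
Proof.
move=> Pinv; have [Ppf _] := Pinv.
have [m [a aE]] := localized_generation Pinv.
have [n [b bE]] := sheared_generation Pinv.
pose E := pencil_den K; pose D := sheared_den K.
pose p i := D ^+ n * (E * a i) - E ^+ m.+1 * b i.
have pE c i : (p i).@[c] = D.@[c] ^+ n * (E.@[c] * (a i).@[c])
     - E.@[c] ^+ m.+1 * (b i).@[c].
  have gen (d e g h : {mpoly K[10]}) : (d ^+ n * (e * g) - e ^+ m.+1 * h).@[c] =
      d.@[c] ^+ n * (e.@[c] * g.@[c]) - e.@[c] ^+ m.+1 * h.@[c].
    by rewrite mevalB (mevalM _ (d ^+ n)) (mevalM _ e) (mevalM _ (e ^+ m.+1))
      !rmorphXn.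
  exact: gen.
have p0 v : \sum_(i < 3) (p i).@[fvec v] * f11 v ^+ i = 0.
  transitivity ((D.@[fvec v] ^+ n * E.@[fvec v])
      * (\sum_(i < 3) (a i).@[fvec v] * f11 v ^+ i)
    - E.@[fvec v] ^+ m.+1 * (\sum_(i < 3) (b i).@[fvec v] * f11 v ^+ i)).
    by rewrite !big_ord3 !pE; ring.
  by rewrite -aE -bE exprS; ring.
have coprime i : exists q : {mpoly K[10]}, forall c, (E ^+ m.+1).@[c] != 0 ->
    (b i).@[c] = (D ^+ n).@[c] * q.@[c].
  apply: (monic_coprime (a := E * a i)).
  - by rewrite isolateXn monic_exp // sheared_den_monic.
  - by move=> c t; rewrite !rmorphXn /= pencil_den_last_free.
  move=> c; rewrite rmorphXn expf_eq0 /= => dc.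
  have := annihilator_vanishes p0 i dc; rewrite pE => /eqP.
  by rewrite subr_eq0 => /eqP; rewrite (mevalM _ E (a i)) !rmorphXn.
have [r rE] := choice coprime.
exists r => v; apply/eqP; rewrite -subr_eq0; apply/eqP; move: v.
pose N v := E.@[fvec v] * D.@[fvec v].
have algP := @polyfun_alg K (V * V * V)%type.
have pN : polynomial_function N by apply: (algM algP); apply: polyfun_meval_fvec.
have pF := algD algP Ppf (algN algP (polyfun_f11_comb r)).
have N0 : N (base_pt K) != 0 by rewrite mulf_neq0 ?base_den ?base_sheared_den.
apply: (polyfun_dense pF pN N0) => v.
have [->|] := eqVneq (N v) 0; first by rewrite mul0r.
rewrite /N mulf_eq0 negb_or => /andP[E0 D0].
apply/eqP; rewrite mulf_eq0; apply/orP; right; rewrite subr_eq0; apply/eqP.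
apply: (mulfI (expf_neq0 n D0)); rewrite bE mulr_sumr; apply: eq_bigr => i _.
rewrite rE; last by rewrite rmorphXn expf_neq0.
by rewrite rmorphXn mulrA.
Qed.

End Generation.

Theorem proposition5p1 (R : realType) :
  free_module_basis (adjoin (f1_to_f10 R[i])) (@invariants3 R[i])
    [tuple 1; f11 (K := R[i]); f11 (K := R[i]) ^+ 2].
Proof.
pose K : numClosedFieldType := R[i].
have polyC (c : K) := algC (@polyfun_alg K _) c.
have inv_meval (p : {mpoly K[10]}) : @invariants3 K (fun v => p.@[fvec v]).
  split; first exact: polyfun_meval_fvec.
  by move=> g dg v; rewrite fvec_congr.
have inv0 : @invariants3 K 0 by split=> //; apply: polyC.
have inv1 : @invariants3 K 1 by split=> //; apply: polyC.
have invf : @invariants3 K (@f11 K).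
  by split; [exact: polyfun_f11 | move=> g dg v; rewrite f11_congr].
have invM F G : @invariants3 K F -> invariants3 G -> @invariants3 K (F * G).
  move=> [pF iF] [pG iG]; split; first exact: (algM (polyfun_alg _) pF pG).
  by move=> g dg v; rewrite -[LHS]/(F _ * G _) iF // iG.
have invD F G : @invariants3 K F -> invariants3 G -> @invariants3 K (F + G).
  move=> [pF iF] [pG iG]; split; first exact: (algD (polyfun_alg _) pF pG).
  by move=> g dg v; rewrite -[LHS]/(F _ + G _) iF // iG.
have sumE (c : 'I_3 -> {mpoly K[10]}) v :
    (\sum_(i < 3) (fun w => (c i).@[fvec w])
       * tnth [tuple 1; @f11 K; @f11 K ^+ 2] i) v
    = \sum_(i < 3) (c i).@[fvec v] * f11 v ^+ i.
  by rewrite !big_ord3 expr0 expr1 !expr2; exact: erefl.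
split.
- split.
  + by exists 1; apply/funext => v; rewrite meval1.
  + by move=> _ _ [a ->] [b ->]; exists (a - b); apply/funext => v; rewrite mevalB.
  + by move=> _ _ [a ->] [b ->]; exists (a * b); apply/funext => v; rewrite mevalM.
- by split=> // b u [p ->]; exact: invM.
- by apply: ord3P; [exact: inv1 | exact: invf | exact: (invM _ _ invf invf)].
- move=> u /f11_generation[a aE].
  exists (fun i v => (a i).@[fvec v]); first by move=> i; exists (a i).
  by apply/funext => v; rewrite sumE.
move=> c /choice[a cE] c0 i.
have {}cE : c = fun i v => (a i).@[fvec v] by apply/funext => j; rewrite cE.
rewrite cE in c0 *; apply/funext => v; apply: f11_combination_unique => w.
by rewrite -sumE c0.
Qed.
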